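(* For every triple $(i,j,k)\in\{0,1\}^3$ with $(i,j)\neq(0,1)$ there exists a set $B\subseteq\mathbb{N}$ such that: $B$ is Besicovitch if and only if $i=1$; $B'$ is Besicovitch if and only if $j=1$; and $B^*$ is Besicovitch if and only if $k=1$.
   Context: $\mathbb{N}=\{1,2,\dots\}$. For $B\subseteq\mathbb{N}$ let $\mathcal{M}_B=\bigcup_{b\in B}b\mathbb{Z}$ be its set of multiples. For $A\subseteq\mathbb{Z}$, the natural density is $d(A)=\lim_{n\to\infty}\frac1n|A\cap[1,n]|$ (if it exists) and the logarithmic density is $\delta(A)=\lim_{n\to\infty}\frac{1}{\ln n}\sum_{1\le k\le n,\,k\in A}\frac1k$; $\delta(\mathcal{M}_B)$ exists for every $B\subseteq\mathbb{N}$ (Davenport--Erdős). $B$ is Besicovitch if $d(\mathcal{M}_B)$ exists. $B$ is Behrend if $B\subseteq\mathbb{N}\setminus\{1\}$ and $\delta(\mathcal{M}_B)=1$. $B^{prim}=B\setminus\bigcup_{k\ge2}kB$. For $c\in\mathbb{N}$ and $A\subseteq\mathbb{N}$, $cA=\{ca:a\in A\}$. Put $C(B)=\{c\in\mathbb{N}: cA\subseteq B\text{ for some Behrend set }A\}$ and $D(B)=\{d\in\mathbb{N}: dA\subseteq B\text{ for some infinite pairwise coprime set }A\subseteq\mathbb{N}\}$. The tautification of $B$ is $B'=(B\cup C(B))^{prim}$, and $B^*=(B\cup D(B))^{prim}$. *)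

(* Defs.v *)
From HB Require Import structures.
From mathcomp Require Import all_boot all_order all_algebra.
From mathcomp Require Import all_classical all_reals all_analysis.

Set Implicit Arguments.
Unset Strict Implicit.
Unset Printing Implicit Defensive.

Import Order.TTheory GRing.Theory Num.Theory.
Import numFieldNormedType.Exports.

Local Open Scope classical_set_scope.
Local Open Scope ring_scope.

(* Subsets of {1, 2, ...} are sets [B : set nat] with [B `<=` posnat]. *)
Definition posnat : set nat := [set n | (0 < n)%N].

Definition dilate (c : nat) (A : set nat) : set nat :=
  [set (c * a)%N | a in A].

Definition multiples (B : set nat) : set int :=
  \bigcup_(b in B) [set z : int | (b%:Z %| z)%Z].

(* In the two densities the term of index n = 0 (and, for the logarithmic one,
   n = 1) is a junk division by 0; it is irrelevant to the limit. *)
Definition is_natural_density (R : realType) (A : set int) (d : R) : Prop :=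
  ((\sum_(1 <= k < n.+1 | k%:Z \in A) 1) / n%:R : R) @[n --> \oo] --> d.

Definition is_log_density (R : realType) (A : set int) (d : R) : Prop :=
  ((\sum_(1 <= k < n.+1 | k%:Z \in A) k%:R^-1) / ln n%:R : R)
    @[n --> \oo] --> d.

Definition Besicovitch (R : realType) (B : set nat) : Prop :=
  exists d : R, is_natural_density (multiples B) d.

Definition Behrend (R : realType) (B : set nat) : Prop :=
  B `<=` posnat `\ 1%N /\ is_log_density (multiples B) (1 : R).

Definition primitive_part (B : set nat) : set nat :=
  B `\` \bigcup_(k in [set k : nat | (2 <= k)%N]) dilate k B.

Definition pairwise_coprime (A : set nat) : Prop :=
  forall a b : nat, A a -> A b -> a <> b -> coprime a b.

Definition Behrend_dilators (R : realType) (B : set nat) : set nat :=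
  [set c | posnat c /\ exists A : set nat, Behrend R A /\ dilate c A `<=` B].

Definition coprime_dilators (B : set nat) : set nat :=
  [set d | posnat d /\ exists A : set nat,
     [/\ A `<=` posnat, infinite_set A, pairwise_coprime A
       & dilate d A `<=` B]].

Definition tautification (R : realType) (B : set nat) : set nat :=
  primitive_part (B `|` Behrend_dilators R B).

Definition star (B : set nat) : set nat :=
  primitive_part (B `|` coprime_dilators B).

(* Main.v *)
Require Import Defs.
From HB Require Import structures.
From mathcomp Require Import all_boot all_order all_algebra.
From mathcomp Require Import all_classical all_reals all_analysis.
From mathcomp Require Import zify ring lra.

Set Implicit Arguments.
Unset Strict Implicit.
Unset Printing Implicit Defensive.

Import Order.TTheory GRing.Theory Num.Theory.
Import numFieldNormedType.Exports.

Local Open Scope classical_set_scope.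
Local Open Scope ring_scope.

(** Write M(X) for the set of multiples of X; passing to the primitive part does not
    change M(X). Choose scales T_0 << T_1 << ... and finite prime sets P_0, P_1, ...
    By Turán's inequality most integers have about L_s = sum_{p in P_s} 1/p prime
    factors in P_s. Let E be the union of the blocks of those d in (T_i, 2 T_i] that
    have at least 3/4 L_s of them for all s <= i. A multiple d m with d in a block and
    m typical has 3/2 L_s such factors, so a block has few multiples although it fills
    most of (T_i, 2 T_i]; hence M(E) has no natural density. Rapid growth makes late
    blocks negligible against residue classes modulo the early ones, so no dilator of a
    Behrend set enlarges M(E); and since elements of late blocks have a factor in each
    early P_s, no dilator of an infinite coprime set does either. Adding T_i + 1,
    coprime to all earlier blocks, to each block puts 1 among the coprime dilators.

    E itself (without or with the T_i + 1) settles (0,0,k). Replacing each e in block i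
    by all e m with m > T_(i+1) gives a set whose natural density exists, while every
    e is dilator of the Behrend set {m > T_(i+1)}: this is (1,0,k). Replacing E by the
    products e p_i with e <= i, for p_i pairwise coprime and growing fast, gives (1,1,0).
    The set {1} gives (1,1,1). *)

(** * Sums over sets of integers *)

(** A single weighted sum covers counting and harmonic sums, so that union bounds and tail estimates
    are proved once for both densities. *)
Definition wsum (R : realType) (w : nat -> R) (X : set nat) (n : nat) : R :=
  \sum_(1 <= k < n.+1 | k \in X) w k.

Definition cnt (R : realType) : set nat -> nat -> R := wsum (fun=> 1).

Definition lsum (R : realType) : set nat -> nat -> R :=
  wsum (fun k => k%:R^-1).

(** Natural-number form of [multiples], to which both densities reduce by computation. It contains 0
    for nonempty [B], but all sums start at 1. *)
Definition mult (B : set nat) : set nat :=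
  [set n | exists2 b, B b & (b %| n)%N].

Lemma wsum0 (R : realType) (w : nat -> R) X : wsum w X 0 = 0.
Proof. by rewrite /wsum big_geq. Qed.

Lemma wsumS (R : realType) (w : nat -> R) X n :
  wsum w X n.+1 = wsum w X n + (if n.+1 \in X then w n.+1 else 0).
Proof. by rewrite /wsum [LHS]big_mkcond big_nat_recr//= -big_mkcond. Qed.

Lemma wsum_ge0 (R : realType) (w : nat -> R) X n :
  (forall k, 0 <= w k) -> 0 <= wsum w X n.
Proof. by move=> w0; apply: sumr_ge0. Qed.

Lemma inv_nat_ge0 (R : realType) (k : nat) : 0 <= k%:R^-1 :> R.
Proof. by rewrite invr_ge0. Qed.

(** Union bound. The cover is only asked for up to [n], so an infinite family may be cut down to the
    members that reach [n]. *)
Lemma wsum_le_bigU (R : realType) (w : nat -> R) (I : eqType) (s : seq I)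
    (F : I -> set nat) X n : (forall k, 0 <= w k) ->
  (forall k, (0 < k <= n)%N -> X k -> exists2 i, i \in s & F i k) ->
  wsum w X n <= \sum_(i <- s) wsum w (F i) n.
Proof.
move=> w0; elim: n => [|n IH] h.
  by rewrite wsum0 sumr_ge0// => i _; exact: wsum_ge0.
under eq_bigr do rewrite wsumS.
rewrite wsumS big_split lerD//; first apply: IH => k /andP[k0 kn].
  by apply: h; rewrite k0 (leq_trans kn).
have ge0 i : 0 <= (if n.+1 \in F i then w n.+1 else 0) by case: ifP.
case: ifPn => [/set_mem Xn|_]; last exact: sumr_ge0.
have /h/(_ Xn)[i si Fi] : (0 < n.+1 <= n.+1)%N by rewrite ltnS leqnn.
elim: s si {h IH} => // j s IH; rewrite inE big_cons.
case/predU1P => [<-|si]; first by rewrite mem_set// lerDl sumr_ge0.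
by rewrite (le_trans (IH si))// lerDr.
Qed.

Lemma wsum_leU (R : realType) (w : nat -> R) X Y Z n : (forall k, 0 <= w k) ->
  (forall k, (0 < k <= n)%N -> X k -> Y k \/ Z k) ->
  wsum w X n <= wsum w Y n + wsum w Z n.
Proof.
move=> w0 h.
have := @wsum_le_bigU R w _ [:: true; false] (fun b => if b then Y else Z) X n w0.
rewrite !big_cons big_nil addr0; apply => k kn Xk.
by have [] := h _ kn Xk; [exists true|exists false].
Qed.

Lemma wsum_le (R : realType) (w : nat -> R) X Y n : (forall k, 0 <= w k) ->
  (forall k, (0 < k <= n)%N -> X k -> Y k) -> wsum w X n <= wsum w Y n.
Proof.
move=> w0 h.
have := @wsum_le_bigU R w _ [:: tt] (fun=> Y) X n w0.
by rewrite big_seq1; apply => k kn Xk; exists tt => //; exact: h Xk.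
Qed.

Lemma eq_wsum (R : realType) (w : nat -> R) X Y n :
  (forall k, (0 < k <= n)%N -> X k <-> Y k) -> wsum w X n = wsum w Y n.
Proof.
move=> h; rewrite /wsum [LHS]big_nat_cond [RHS]big_nat_cond.
apply: eq_bigl => k; case: (boolP (0 < k < n.+1)%N) => //= kn.
by apply/idP/idP => /set_mem/(h k kn) ?; exact/mem_set.
Qed.

Lemma wsumC (R : realType) (w : nat -> R) X n :
  wsum w (~` X) n = wsum w setT n - wsum w X n.
Proof.
elim: n => [|n IH]; first by rewrite !wsum0 subrr.
by rewrite !wsumS IH in_setC in_setT; case: (_ \in X) => /=; lra.
Qed.

Lemma wsum_le_leq (R : realType) (w : nat -> R) X m n : (forall k, 0 <= w k) ->
  (m <= n)%N -> wsum w X m <= wsum w X n.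
Proof.
move=> w0 /subnK <-; elim: (n - m)%N => //= k IH.
by rewrite addSn wsumS (le_trans IH)// lerDl; case: ifP.
Qed.

Lemma cntT (R : realType) n : cnt R setT n = n%:R.
Proof.
by elim: n => [|n IH]; rewrite /cnt ?wsum0// wsumS -/(cnt R _) IH in_setT -natr1.
Qed.

Lemma cnt_le (R : realType) X n : cnt R X n <= n%:R.
Proof. by rewrite -[leRHS]cntT; apply: wsum_le. Qed.

Lemma sum_dvdn (R : realType) d n : (0 < d)%N ->
  \sum_(1 <= k < n.+1) (d %| k)%N%:R = (n %/ d)%:R :> R.
Proof.
move=> d0; elim: n => [|n IH]; first by rewrite big_geq// div0n.
by rewrite big_nat_recr//= IH divnS// natrD addrC.
Qed.

Lemma floor_div_le (R : realType) n d : (n %/ d)%:R <= n%:R / d%:R :> R.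
Proof.
case: (posnP d) => [->|d0]; first by rewrite divn0 invr0 mulr0.
by rewrite ler_pdivlMr ?ltr0n// -natrM ler_nat leq_trunc_div.
Qed.

Lemma floor_div_ge (R : realType) n d : (0 < d)%N ->
  n%:R / d%:R - 1 <= (n %/ d)%:R :> R.
Proof.
move=> d0; rewrite lerBlDr ler_pdivrMr ?ltr0n// natr1 -natrM ler_nat.
by rewrite ltnW// ltn_ceil.
Qed.

Lemma wsum_cond (R : realType) (w : nat -> R) X n :
  wsum w X n = \sum_(1 <= k < n.+1) (k \in X)%:R * w k.
Proof.
by rewrite /wsum big_mkcond; apply: eq_bigr => k _; case: ifP; rewrite ?mul1r ?mul0r.
Qed.

Lemma cnt_dvd_le (R : realType) d n : (0 < d)%N ->
  cnt R [set k | (d %| k)%N] n <= n%:R / d%:R.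
Proof.
move=> d0; apply: le_trans (floor_div_le R n d).
rewrite -sum_dvdn// /cnt wsum_cond ler_sum// => k _; rewrite mulr1.
by case: (boolP (_ \in _)) => //= /set_mem/= ->.
Qed.

Lemma cntD_periodic (R : realType) q X n :
  (forall k, (0 < k)%N -> X (k + q)%N <-> X k) ->
  cnt R X (q + n) = cnt R X q + cnt R X n.
Proof.
move=> per; elim: n => [|n IH]; first by rewrite addn0 [cnt R X 0]wsum0 addr0.
rewrite addnS /cnt !wsumS -!/(cnt R _ _) IH -addrA; congr (_ + (_ + _)).
congr (if _ then _ else _); rewrite -addnS addnC.
by apply/idP/idP => /set_mem/(per n.+1 isT) ?; exact/mem_set.
Qed.

(** Removing a full period lowers both terms by [c]; for [n < q] both lie between 0 and [q]. The
    error is thus uniform in [n]. *)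
Lemma cnt_periodic (R : realType) q X n : (0 < q)%N ->
  (forall k, (0 < k)%N -> X (k + q)%N <-> X k) ->
  `|cnt R X n - cnt R X q / q%:R * n%:R| <= q%:R.
Proof.
move=> q0 per; set c := cnt R X q.
have c0 : 0 <= c by exact: wsum_ge0.
have cq : c <= q%:R by exact: cnt_le.
have q0R : 0 < q%:R :> R by rewrite ltr0n.
elim/ltn_ind: n => n IH; have [qn|nq] := leqP q n.
  have -> : cnt R X n - c / q%:R * n%:R =
            cnt R X (n - q) - c / q%:R * (n - q)%N%:R.
    rewrite -{1}(subnKC qn) cntD_periodic// -/c natrB//; field; lra.
  by apply: IH; lia.
have a0 : 0 <= cnt R X n by exact: wsum_ge0.
have an : cnt R X n <= n%:R by exact: cnt_le.
have nqR : n%:R <= q%:R :> R by rewrite ler_nat ltnW.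
have b0 : 0 <= c / q%:R * n%:R by rewrite mulr_ge0// divr_ge0// ltW.
have bq : c / q%:R * n%:R <= q%:R.
  apply: le_trans nqR; rewrite -[leRHS]mul1r ler_wpM2r//.
  by rewrite ler_pdivrMr// mul1r.
by rewrite ler_norml; apply/andP; split; lra.
Qed.

Lemma multS A B : A `<=` B -> mult A `<=` mult B.
Proof. by move=> AB n [b Bb bn]; exists b => //; exact: AB. Qed.

Lemma sub_mult B : B `<=` mult B.
Proof. by move=> b Bb; exists b. Qed.

Lemma mult_mono B m n : mult B m -> (m %| n)%N -> mult B n.
Proof. by move=> [b Bb bm] mn; exists b => //; exact: dvdn_trans mn. Qed.

Lemma mult_idem B C : B `<=` mult C -> mult B `<=` mult C.
Proof. by move=> BC n [b /BC bC bn]; exact: mult_mono bn. Qed.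

Lemma mult_periodic B q : (forall b, B b -> (b %| q)%N) ->
  forall k, mult B (k + q)%N <-> mult B k.
Proof.
by move=> Bq k; split => -[b Bb bk]; exists b => //;
  move: bk; rewrite dvdn_addl//; exact: Bq.
Qed.

(** Summation by parts with the decreasing weights [1 / k]. *)
Lemma abel_inv_le (R : realType) (u : nat -> R) (C : R) (n : nat) :
  0 <= C -> (forall m, \sum_(1 <= k < m.+1) u k <= C) ->
  \sum_(1 <= k < n.+1) u k / k%:R <= C.
Proof.
move=> C0 h; pose D m := \sum_(1 <= k < m.+1) u k.
case: n => [|n]; first by rewrite big_geq.
(* The induction carries the slack [C - D n.+1] of the partial sum, which the next term may use up;
   the bare bound would forget it. *)
suff: \sum_(1 <= k < n.+2) u k / k%:R <= C - (C - D n.+1) / n.+1%:R.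
  move=> /le_trans; apply; rewrite lerBlDr lerDl divr_ge0// subr_ge0; exact: h.
elim: n => [|n IH].
  by rewrite /D !big_nat1 !divr1; lra.
rewrite big_nat_recr//=.
have -> : D n.+2 = D n.+1 + u n.+2 by rewrite /D big_nat_recr.
have : (C - D n.+1) / n.+2%:R <= (C - D n.+1) / n.+1%:R.
  rewrite ler_wpM2l// ?subr_ge0 ?(h n.+1)// lef_pV2 ?posrE ?ltr0n// ler_nat; lia.
have -> : C - (C - (D n.+1 + u n.+2)) / n.+2%:R =
          C - (C - D n.+1) / n.+2%:R + u n.+2 / n.+2%:R by ring.
by rewrite lerD2r => h1; apply: (le_trans IH); rewrite lerD2l lerN2.
Qed.

(** The centred indicator of [X], with [a] subtracted, has partial sums at most [C], so Abel
    summation passes to harmonic sums without enlarging the error. *)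
Lemma lsum_le_cnt (R : realType) (a C : R) X n : 0 <= C ->
  (forall m, cnt R X m <= a * m%:R + C) ->
  lsum R X n <= a * lsum R setT n + C.
Proof.
move=> C0 h; rewrite -lerBlDl.
have -> : lsum R X n - a * lsum R setT n =
  \sum_(1 <= k < n.+1) ((k \in X)%:R - a) / k%:R.
  rewrite /lsum !wsum_cond mulr_sumr -sumrB; apply: eq_bigr => k _.
  by rewrite in_setT mul1r mulrBl.
apply: abel_inv_le => // m; rewrite sumrB lerBlDl.
have -> : \sum_(1 <= k < m.+1) a = a * m%:R.
  by rewrite sumr_const_nat subSS subn0 mulr_natr.
suff -> : \sum_(1 <= k < m.+1) (k \in X)%:R = cnt R X m by [].
by rewrite /cnt wsum_cond; under [RHS]eq_bigr do rewrite mulr1.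
Qed.

Lemma lsum_ge_cnt (R : realType) (a C : R) X n : 0 <= C ->
  (forall m, a * m%:R - C <= cnt R X m) ->
  a * lsum R setT n - C <= lsum R X n.
Proof.
move=> C0 h; have : lsum R (~` X) n <= (1 - a) * lsum R setT n + C.
  apply: lsum_le_cnt => // m; rewrite /cnt wsumC -!/(cnt R _ _) cntT.
  have := h m; lra.
rewrite /lsum wsumC -!/(lsum R _ _); lra.
Qed.

Lemma wsum_dilate (R : realType) (w : nat -> R) c X n : (0 < c)%N ->
  wsum w (dilate c X) n = wsum (fun k => w (c * k)%N) X (n %/ c).
Proof.
move=> c0; elim: n => [|n IH]; first by rewrite div0n !wsum0.
rewrite wsumS IH divnS//; have [/dvdnP[x xE]|ndvd] := boolP (c %| n.+1)%N; last first.
  rewrite add0n -[RHS]addr0; congr (_ + _); case: ifPn => // /set_mem[x _ cx].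
  by rewrite -cx dvdn_mulr in ndvd.
have xS : (n %/ c).+1 = x.
  by have := divnS n c0; rewrite xE dvdn_mull// mulnK// add1n => ->.
have cx : (c * x)%N = n.+1 by rewrite mulnC.
rewrite [(true + _)%N]add1n wsumS xS cx.
suff -> : (n.+1 \in dilate c X) = (x \in X) by [].
apply/idP/idP => /set_mem Xx; apply/mem_set; last by exists x.
by case: Xx => y Xy; rewrite -cx => /eqP; rewrite eqn_pmul2l// => /eqP <-.
Qed.

Lemma cnt_dilate (R : realType) c X n : (0 < c)%N ->
  cnt R (dilate c X) n = cnt R X (n %/ c).
Proof. exact: wsum_dilate. Qed.

Lemma lsum_dilate_le (R : realType) c X n : (0 < c)%N ->
  lsum R (dilate c X) n <= c%:R^-1 * lsum R X n.
Proof.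
move=> c0; rewrite /lsum wsum_dilate//.
apply: (@le_trans _ _ (c%:R^-1 * lsum R X (n %/ c))).
  by rewrite /lsum /wsum mulr_sumr; under eq_bigr do rewrite natrM invfM.
rewrite ler_wpM2l ?inv_nat_ge0//.
by apply: wsum_le_leq => [k|]; rewrite ?inv_nat_ge0// leq_div.
Qed.

(** * Harmonic sums and reciprocals of primes *)

(** Both inductions use [ln (1 + x) <= x]: with [x = 1 / m.+1] for the lower bound and
    [x = - 1 / n.+2] for the upper one. *)
Lemma harm_bounds (R : realType) n : (0 < n)%N ->
  ln n%:R <= lsum R setT n <= 1 + ln n%:R.
Proof.
move=> n0; have hS m : lsum R setT m.+1 = lsum R setT m + m.+1%:R^-1.
  by rewrite /lsum wsumS in_setT.
have h1 m : ln (m.+1%:R : R) <= lsum R setT m.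
  elim: m => [|m IH]; first by rewrite ln1 /lsum wsum0.
  rewrite hS; apply: le_trans (_ : ln m.+1%:R + m.+1%:R^-1 <= _); last by rewrite lerD2r.
  have -> : m.+2%:R = m.+1%:R * (1 + m.+1%:R^-1) :> R.
    by rewrite mulrDr mulr1 divff ?natr1// pnatr_eq0.
  rewrite lnM ?posrE ?ltr0n// ?ltr_pwDl ?invr_ge0// lerD2l le_ln1Dx//.
  by rewrite (@lt_le_trans _ _ 0)// ?ltrN10 ?invr_ge0.
apply/andP; split.
  apply: le_trans (h1 n); rewrite ler_ln ?posrE ?ltr0n// ler_nat//.
case: n n0 => // n _; elim: n => [|n IH].
  by rewrite hS ln1 addr0 /lsum wsum0 add0r invr1.
rewrite hS; apply: le_trans (_ : 1 + ln n.+1%:R + n.+2%:R^-1 <= _); first by rewrite lerD2r.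
rewrite -addrA lerD2l.
have -> : n.+1%:R = n.+2%:R * (1 + - n.+2%:R^-1) :> R.
  rewrite mulrDr mulr1 mulrN divff ?pnatr_eq0// -[n.+2%:R]natr1; lra.
have i1 : n.+2%:R^-1 < 1 :> R by rewrite invf_lt1 ?ltr0n// ltr1n.
rewrite lnM ?posrE ?ltr0n// ?subr_gt0// -addrA gerDl -lerBrDr sub0r.
by rewrite le_ln1Dx// ltrN2.
Qed.

Lemma harm_unbounded (R : realType) (x : R) :
  exists n0, forall n, (n0 <= n)%N -> x <= lsum R setT n.
Proof.
exists (Num.bound (expR x)) => n xn.
have e0 : 0 <= expR x by exact: expR_ge0.
have hn : expR x <= n%:R.
  by apply/ltW/(lt_le_trans (archi_boundP e0)); rewrite ler_nat.
have n0 : (0 < n)%N by rewrite -(ltr0n R) (lt_le_trans _ hn)// expR_gt0.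
have /andP[+ _] := harm_bounds R n0; apply: le_trans.
by rewrite -[leLHS]expRK ler_ln ?posrE ?expR_gt0 ?ltr0n.
Qed.

Definition smooth (N : nat) : set nat :=
  [set k | (0 < k)%N /\ forall p, prime p -> (p %| k)%N -> (p <= N)%N].

(* Euler product: [1 / (1 - 1/p) <= exp (2/p)]. *)
Lemma lsum_smooth_le (R : realType) N n :
  lsum R (smooth N) n <= expR (2 * lsum R [set p | prime p] N).
Proof.
elim: N => [|N IH].
  rewrite {2}/lsum wsum0 mulr0 expR0.
  case: n => [|n]; first by rewrite /lsum wsum0.
  apply: le_trans (_ : lsum R [set 1%N] n.+1 <= 1).
    apply: wsum_le => k; rewrite ?inv_nat_ge0// => k0 [_ ks].
    have [/eqP//|k1] := boolP (k == 1)%N.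
    have /ks : prime (pdiv k) by rewrite pdiv_prime//; lia.
    by rewrite pdiv_dvd leqn0 => /(_ isT)/eqP p0; have := pdiv_gt0 k; rewrite p0.
  elim: n => [|n IH].
    by rewrite /lsum wsumS wsum0 add0r; case: ifP; rewrite // invr1.
  rewrite /lsum wsumS -/(lsum _ _ _) ifN ?addr0//.
  by apply/negP => /set_mem.
have [pN|npN] := boolP (prime N.+1); last first.
  rewrite {2}/lsum wsumS ifN ?addr0; last by apply/negP => /set_mem; rewrite /= (negbTE npN).
  apply: le_trans IH; apply: wsum_le => k; rewrite ?inv_nat_ge0// => _ [k0 ks].
  split=> // p pp pk; have := ks p pp pk; rewrite leq_eqVlt => /predU1P[pE|//].
  by rewrite -pE pp in npN.
set q := N.+1 in pN *.
have -> : lsum R [set p | prime p] q = lsum R [set p | prime p] N + q%:R^-1.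
  by rewrite /lsum wsumS mem_set.
(* A [q]-smooth number is either [N]-smooth or [q] times a [q]-smooth number; the second kind
   returns the sum being bounded, with factor [1 / q]. *)
have h : lsum R (smooth q) n <=
         lsum R (smooth N) n + lsum R (dilate q (smooth q)) n.
  apply: wsum_leU => k; rewrite ?inv_nat_ge0// => /andP[k0 _] [_ ks].
  have [/dvdnP[j jE]|nqk] := boolP (q %| k)%N; [right|left].
    exists j; last by rewrite mulnC.
    split=> [|p pp pj]; first by move: k0; rewrite jE; case: j {jE}.
    by apply: ks => //; rewrite jE dvdn_mulr.
  split=> // p pp pk; have := ks p pp pk; rewrite leq_eqVlt => /predU1P[pE|//].
  by rewrite -pE pk in nqk.
have q0 : (0 < q)%N by [].
have {}h := le_trans h (lerD IH (lsum_dilate_le R (smooth q) n q0)).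
have q2 : (2 <= q)%N by exact: prime_gt1.
rewrite mulrDr expRD.
apply: le_trans (_ : expR (2 * lsum R [set p | prime p] N) * (1 + 2 * q%:R^-1) <= _);
  last by rewrite ler_wpM2l ?expR_ge0 ?expR_ge1Dx.
move: h; set E := expR _; set x := lsum R (smooth q) n => h.
have x0 : 0 <= x by apply: wsum_ge0 => k; rewrite inv_nat_ge0.
have E0 : 0 < E by exact: expR_gt0.
have i0 : 0 < q%:R^-1 :> R by rewrite invr_gt0 ltr0n.
have i2 : q%:R^-1 <= 2^-1 :> R by rewrite lef_pV2 ?posrE ?ltr0n// ler_nat.
move: h i0 i2; set y := q%:R^-1 => h i0 i2.
(* As [y <= 1/2], [(1 - y) (1 + 2 y) >= 1], so the factor [1 + 2 y] compensates [1 - y]. *)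
have h1 : x * (1 - y) * (1 + 2 * y) <= E * (1 + 2 * y).
  by rewrite ler_wpM2r//; [lra|nra].
apply: le_trans h1.
have -> : x * (1 - y) * (1 + 2 * y) = x + x * y * (1 - 2 * y) by ring.
by rewrite lerDl !mulr_ge0//; lra.
Qed.

(** Euler's argument: every [k <= N] is [N]-smooth, so the harmonic sum is dominated by the
    exponential of twice the prime sum. *)
Lemma lsum_prime_unbounded (R : realType) (x : R) :
  exists N, x <= lsum R [set p | prime p] N.
Proof.
have [N /(_ N (leqnn N)) hN] := harm_unbounded (expR (2 * x)).
exists N; have : expR (2 * x) <= expR (2 * lsum R [set p | prime p] N).
  apply: (le_trans hN); apply: le_trans (lsum_smooth_le R N N).
  apply: wsum_le => k; rewrite ?inv_nat_ge0// => /andP[k0 kN] _.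
  by split=> // p _ pk; apply: leq_trans kN; exact: dvdn_leq pk.
by rewrite ler_expR; lra.
Qed.

Lemma prime_block_exists (R : realType) (m : nat) (x : R) :
  exists P : seq nat, [/\ uniq P, (forall p, p \in P -> prime p /\ (m < p)%N) &
    x <= \sum_(p <- P) p%:R^-1].
Proof.
have [N hN] := lsum_prime_unbounded (lsum R [set p | prime p] m + x).
exists [seq p <- index_iota m.+1 N.+1 | prime p]; split.
- by rewrite filter_uniq// iota_uniq.
- by move=> p; rewrite mem_filter mem_index_iota => /andP[-> /andP[-> _]].
have pE (p : nat) : (p \in [set p | prime p]) = prime p.
  by apply/idP/idP => [/set_mem//|?]; exact/mem_set.
rewrite big_filter; have [Nm|mN] := leqP N m.
  have := @wsum_le_leq R (fun k => k%:R^-1) [set p | prime p] N m (inv_nat_ge0 R) Nm.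
  rewrite -!/(lsum _ _ _) big_geq ?ltnS// => h; lra.
have E : lsum R [set p | prime p] N =
    lsum R [set p | prime p] m + \sum_(m.+1 <= p < N.+1 | prime p) p%:R^-1.
  rewrite /lsum /wsum (@big_cat_nat _ _ _ m.+1)//= ?ltnS 1?ltnW//.
  by congr (_ + _); apply: eq_bigl => p; rewrite pE.
by move: hN; rewrite E lerD2l.
Qed.

(** * Turán's inequality *)

Definition omega (R : realType) (P : seq nat) (k : nat) : R :=
  \sum_(p <- P) (p %| k)%N%:R.

Lemma omega_mean_ge (R : realType) (P : seq nat) n :
  (forall p, p \in P -> prime p) ->
  n%:R * (\sum_(p <- P) p%:R^-1) - (size P)%:R
    <= \sum_(1 <= k < n.+1) omega R P k.
Proof.
move=> Pp; rewrite exchange_big/= mulr_sumr.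
have -> : (size P)%:R = \sum_(p <- P) 1 :> R by rewrite big_const_seq count_predT iter_addr_0.
rewrite -sumrB big_seq [leRHS]big_seq ler_sum// => p /Pp/prime_gt0 p0.
by rewrite sum_dvdn// floor_div_ge.
Qed.

(** The square expands over pairs of primes: distinct primes are coprime and contribute at most
    [n / (p q)], the diagonal at most [n / p], which is the extra [L]. *)
Lemma omega_square_le (R : realType) (P : seq nat) n :
  uniq P -> (forall p, p \in P -> prime p) ->
  let L : R := \sum_(p <- P) p%:R^-1 in (
  \sum_(1 <= k < n.+1) omega R P k ^+ 2 <= n%:R * (L ^+ 2 + L) : Prop).
Proof.
move=> uP Pp L.
have -> : \sum_(1 <= k < n.+1) omega R P k ^+ 2 =
  \sum_(p <- P) \sum_(q <- P) \sum_(1 <= k < n.+1) ((p %| k) && (q %| k))%N%:R.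
  under eq_bigr do rewrite expr2 mulr_suml.
  rewrite exchange_big; apply: eq_bigr => p _ /=.
  under eq_bigr do rewrite mulr_sumr.
  rewrite exchange_big; apply: eq_bigr => q _ /=.
  by apply: eq_bigr => k _; rewrite -natrM mulnb.
have -> : n%:R * (L ^+ 2 + L) = \sum_(p <- P) \sum_(q <- P)
    (n%:R * (p%:R^-1 * q%:R^-1) + (if q == p then n%:R * p%:R^-1 else 0)).
  under eq_bigr do rewrite big_split/=.
  rewrite big_split/= mulrDr; congr (_ + _).
    rewrite expr2 {1}/L mulr_suml mulr_sumr; apply: eq_bigr => p _.
    by rewrite mulr_sumr mulr_sumr.
  rewrite mulr_sumr big_seq [RHS]big_seq; apply: eq_bigr => p pP.
  by rewrite (bigD1_seq p)//= eqxx big1 ?addr0// => q /negbTE ->.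
rewrite big_seq [leRHS]big_seq ler_sum// => p pP.
rewrite big_seq [leRHS]big_seq ler_sum// => q qP.
have p0 := prime_gt0 (Pp p pP); have q0 := prime_gt0 (Pp q qP).
case: eqVneq => [->|qp].
  under eq_bigr do rewrite andbb.
  by rewrite sum_dvdn// (le_trans (floor_div_le R n p))// lerDr mulr_ge0// mulr_ge0.
rewrite addr0; have cpq : coprime p q.
  by rewrite prime_coprime ?(Pp p pP)// dvdn_prime2 ?(Pp p pP) ?(Pp q qP)// eq_sym.
under eq_bigr do rewrite -Gauss_dvd//.
by rewrite sum_dvdn ?muln_gt0 ?p0// -invfM -natrM floor_div_le.
Qed.

(** Expanding the variance, with the second moment bounded above and the mean below, the [L ^+ 2]
    terms cancel; the last summand collects the rounding of the mean. *)
Lemma turan_kubilius (R : realType) (P : seq nat) n :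
  uniq P -> (forall p, p \in P -> prime p) ->
  let L : R := \sum_(p <- P) p%:R^-1 in (
  \sum_(1 <= k < n.+1) (omega R P k - L) ^+ 2
    <= n%:R * L + 2 * L * (size P)%:R : Prop).
Proof.
move=> uP Pp L; have L0 : 0 <= L by apply: sumr_ge0 => p _; exact: inv_nat_ge0.
have -> : \sum_(1 <= k < n.+1) (omega R P k - L) ^+ 2 =
  \sum_(1 <= k < n.+1) omega R P k ^+ 2
  - 2 * L * \sum_(1 <= k < n.+1) omega R P k + n%:R * L ^+ 2.
  have -> : n%:R * L ^+ 2 = \sum_(1 <= k < n.+1) L ^+ 2.
    by rewrite sumr_const_nat subSS subn0 mulr_natl.
  rewrite mulr_sumr -sumrB -big_split; apply: eq_bigr => k _ /=; ring.
have h2 : \sum_(1 <= k < n.+1) omega R P k ^+ 2 <= n%:R * (L ^+ 2 + L).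
  exact: omega_square_le.
have h1 := omega_mean_ge R n Pp; rewrite -/L in h1.
have : 2 * L * (n%:R * L - (size P)%:R) <=
       2 * L * \sum_(1 <= k < n.+1) omega R P k by rewrite ler_wpM2l// mulr_ge0.
move: h2; rewrite expr2; nra.
Qed.

Lemma cnt_markov (R : realType) (X : set nat) (h : nat -> R) (t : R) n :
  0 < t -> (forall k, 0 <= h k) -> (forall k, X k -> t <= h k) ->
  cnt R X n <= (\sum_(1 <= k < n.+1) h k) / t.
Proof.
move=> t0 h0 ht; rewrite ler_pdivlMr// /cnt wsum_cond mulr_suml ler_sum// => k _.
by rewrite mulr1; case: (boolP (_ \in _)) => [/set_mem/ht|_]; rewrite ?mul1r ?mul0r.
Qed.

(** A prime dividing both factors is counted twice on the left and once in [omega] of the product;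
    then [p ^ 2] divides the product and supplies the missing unit. *)
Lemma omega_superadditive (R : realType) (P : seq nat) d j :
  (forall p, p \in P -> prime p) ->
  omega R P d + omega R P j <=
  omega R P (d * j) + \sum_(p <- P) (p ^ 2 %| d * j)%N%:R.
Proof.
move=> Pp; rewrite -!big_split/= big_seq [leRHS]big_seq ler_sum// => p /Pp pp.
rewrite -!natrD ler_nat Euclid_dvdM//.
have := @dvdn_mul p p d j; rewrite -(expnS p 1) .
by case: (p %| d)%N; case: (p %| j)%N => //= ->.
Qed.

(** Each of the [T] dilates has density at most [e / d < e / T], so on a dyadic interval the total
    density stays [e], whatever [T] is. *)
Lemma interval_multiples_le (R : realType) (g : set nat) (e K : R) T n :
  0 <= e -> 0 <= K -> (forall m, cnt R g m <= e * m%:R + K) ->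
  cnt R [set k | exists2 d, (T < d <= T.*2)%N & dilate d g k] n
    <= e * n%:R + T%:R * K.
Proof.
move=> e0 K0 h.
apply: (@le_trans _ _ (\sum_(d <- index_iota T.+1 T.*2.+1) cnt R (dilate d g) n)).
  apply: wsum_le_bigU => // k _ [d dT gk]; exists d => //.
  by rewrite mem_index_iota.
have [->|T0] := posnP T; first by rewrite big_geq// mul0r addr0 mulr_ge0.
have -> : e * n%:R + T%:R * K = \sum_(d <- index_iota T.+1 T.*2.+1) (e * n%:R / T%:R + K).
  rewrite sumr_const_nat (_ : (_ - _ = T)%N); last by lia.
  by rewrite -[RHS]mulr_natl mulrDr; congr (_ + _); rewrite mulrCA mulfV ?mulr1// pnatr_eq0; lia.
rewrite big_seq [leRHS]big_seq ler_sum// => d; rewrite mem_index_iota => /andP[Td _].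
have d0 : (0 < d)%N by lia.
rewrite cnt_dilate//; apply: (le_trans (h _)); rewrite lerD2r -mulrA ler_wpM2l//.
apply: (le_trans (floor_div_le R n d)); rewrite ler_wpM2l//.
by rewrite lef_pV2 ?posrE ?ltr0n// ler_nat ltnW.
Qed.

(* A good number has at least [3/4] of the expected number [L] of prime factors
   in [P]; a product of two good numbers has at least [3/2 L] of them, counted
   with multiplicity at most two, which is rare. *)
Lemma prime_filter_exists (R : realType) (e : R) (m : nat) : 0 < e ->
  exists (P : seq nat) (g : set nat) (K : R),
    [/\ forall p, p \in P -> prime p /\ (m < p)%N,
        forall k, g k -> exists2 p, p \in P & (p %| k)%N,
        forall n, cnt R (~` g) n <= e * n%:R + K &
        forall T F, (forall d, F d -> (T < d <= T.*2)%N /\ g d) ->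
          exists K', forall n, cnt R (mult F) n <= e * n%:R + K'].
Proof.
move=> e0.
(* The bound [16 / e] makes numbers with many square factors rare, since the sum of [1 / p ^ 2] is
   at most [L / m']; [64 / e] makes Turán's bound [16 / L] at most [e / 4]. *)
pose m' := maxn m (Num.bound (16 / e)).+1.
have [P [uP Pm]] := prime_block_exists m' (64 / e).
set L := \sum_(p <- P) p%:R^-1 => eL.
have Pp p : p \in P -> prime p by move=> /Pm[].
have L0 : 0 < L by rewrite (lt_le_trans _ eL)// divr_gt0.
have m'0 : 0 < m'%:R :> R by rewrite ltr0n leq_max orbT.
have em' : 16 / e <= m'%:R.
  have i0 : 0 <= 16 / e by rewrite divr_ge0// ltW.
  by rewrite (le_trans (ltW (archi_boundP i0)))// ler_nat /m'; lia.
have eL4 : 16 / L <= e / 4.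
  by move: eL; rewrite ler_pdivrMr// ler_pdivrMr//; lra.
have em4 : 4 / m'%:R <= e / 4.
  by move: em'; rewrite ler_pdivrMr// ler_pdivrMr//; lra.
pose K := 32 * (size P)%:R / L.
have K0 : 0 <= K by rewrite divr_ge0 ?(ltW L0)// mulr_ge0.
have dev X n : (forall k, X k -> L / 4 <= `|omega R P k - L|) ->
    cnt R X n <= e / 4 * n%:R + K.
  move=> hX; have L16 : 0 < (L / 4) ^+ 2 by rewrite exprn_gt0// divr_gt0.
  apply: (@le_trans _ _ ((n%:R * L + 2 * L * (size P)%:R) / (L / 4) ^+ 2)).
    apply: le_trans (cnt_markov _ L16 (fun k => sqr_ge0 (omega R P k - L)) _) _.
      move=> k /hX h; rewrite -[leRHS]real_normK ?num_real//.
      by rewrite lerXn2r ?nnegrE// ltW// divr_gt0.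
    by rewrite ler_wpM2r ?turan_kubilius// invr_ge0 ltW.
  have -> : (n%:R * L + 2 * L * (size P)%:R) / (L / 4) ^+ 2 = 16 / L * n%:R + K.
    by rewrite /K; field; rewrite gt_eqF.
  by rewrite lerD2r ler_wpM2r.
pose g : set nat := [set k | 3 / 4 * L <= omega R P k].
have cg n : cnt R (~` g) n <= e / 4 * n%:R + K.
  apply: dev => k /negP; rewrite -ltNge => h.
  by rewrite distrC ger0_norm; lra.
have sq n : cnt R [set k | L / 4 <= \sum_(p <- P) (p ^ 2 %| k)%N%:R] n <= e / 4 * n%:R.
  have L4 : 0 < L / 4 by rewrite divr_gt0.
  pose h k : R := \sum_(p <- P) (p ^ 2 %| k)%N%:R.
  apply: (le_trans (@cnt_markov _ _ h _ n L4 _ _)) => [k|//|]; first exact: sumr_ge0.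
  rewrite ler_pdivrMr// exchange_big/=.
  apply: (@le_trans _ _ (n%:R * (L / m'%:R))).
    rewrite /L !mulr_suml mulr_sumr big_seq [leRHS]big_seq ler_sum// => p /Pm[pp mp].
    have p0 := prime_gt0 pp.
    rewrite sum_dvdn ?expn_gt0 ?p0// (le_trans (floor_div_le R _ _))//.
    rewrite ler_wpM2l// natrX expr2 invfM ler_wpM2l ?invr_ge0//.
    by rewrite lef_pV2 ?posrE// ?ltr0n// ler_nat ltnW.
  have -> : n%:R * (L / m'%:R) = 4 / m'%:R * (n%:R * (L / 4)) by field; rewrite gt_eqF.
  by rewrite -[leRHS]mulrA ler_wpM2r// mulr_ge0// ltW.
exists P, g, K; split.
- by move=> p /Pm[pp mp]; split=> //; move: mp; rewrite /m'; lia.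
- move=> k gk; apply/hasP; apply/contraPT: gk => /hasPn h /=.
  apply/negP; rewrite -ltNge /omega big_seq big1 ?mulr_gt0//.
  by move=> p /h/negbTE ->.
- move=> n; apply: (le_trans (cg n)); rewrite lerD2r ler_wpM2r//; lra.
move=> T F FT; exists (K + T%:R * K) => n.
pose Y := [set k | L / 4 <= `|omega R P k - L|].
pose Z := [set k | L / 4 <= \sum_(p <- P) (p ^ 2 %| k)%N%:R].
pose W := [set k | exists2 d, (T < d <= T.*2)%N & dilate d (~` g) k].
have h : cnt R (mult F) n <= cnt R Y n + (cnt R Z n + cnt R W n).
  apply: le_trans (_ : cnt R Y n + cnt R (Z `|` W) n <= _); last first.
    by rewrite lerD2l; apply: wsum_leU.
  (* For a multiple [j * d]: [j] is not good ([W]), or there are many square factors ([Z]), or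
     [omega] exceeds [3/2 L - L/4 = L + L/4] ([Y]). *)
  apply: wsum_leU => // k _ [d Fd /dvdnP[j ->]].
  have [dT gd] := FT d Fd.
  have [gj|ngj] := pselect (g j); last first.
    by right; right; exists d => //; exists j; rewrite // mulnC.
  have := omega_superadditive R d j Pp; rewrite [(d * j)%N]mulnC => s.
  have [Zk|nZk] := pselect (Z (j * d)%N); first by right; left.
  left; move: gd gj nZk; rewrite /g /Z /Y /= => gd gj /negP; rewrite -ltNge => nZk.
  by rewrite ger0_norm; lra.
have e4 : 0 <= e / 4 by rewrite divr_ge0// ltW.
have hW := @interval_multiples_le R (~` g) (e / 4) K T n e4 K0 cg.
have hY : cnt R Y n <= e / 4 * n%:R + K by apply: dev.
have hZ := sq n.
apply: (le_trans h); have : 0 <= e * n%:R by rewrite mulr_ge0// ltW.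
rewrite -/W -/Z in hW hZ *; lra.
Qed.

(** * Natural density of sets of multiples *)

(* Divisibility in [int] of [k%:Z] by [b%:Z] computes to [b %| k] in [nat]. *)
Lemma BesicovitchE (R : realType) B : Besicovitch R B <->
  exists d : R, (cnt R (mult B) n / n%:R) @[n --> \oo] --> d.
Proof. by []. Qed.

Lemma is_log_densityE (R : realType) A (d : R) :
  is_log_density (multiples A) d =
  ((lsum R (mult A) n / ln n%:R) @[n --> \oo] --> d).
Proof. by []. Qed.

Lemma Besicovitch_congr (R : realType) A B :
  (forall n, (0 < n)%N -> mult A n <-> mult B n) ->
  Besicovitch R A <-> Besicovitch R B.
Proof.
move=> AB; rewrite !BesicovitchE.
suff -> : (fun n => cnt R (mult A) n / n%:R) = (fun n => cnt R (mult B) n / n%:R) by [].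
by apply/funext => n; congr (_ / _); apply: eq_wsum => k /andP[k0 _]; exact: AB.
Qed.

(* A least divisor of [n] in [X] is primitive. *)
Lemma mult_primitive_part X n : X `<=` posnat -> mult (primitive_part X) n <-> mult X n.
Proof.
move=> X0; split=> [|[x Xx xn]]; first by apply: multS => x [].
elim/ltn_ind: x Xx xn => x IH Xx xn.
have [[k /= k2 [y Xy yx]]|nx] := pselect ((\bigcup_(k in [set k : nat | (2 <= k)%N]) dilate k X) x).
  apply: (IH y) => //; last by apply: dvdn_trans xn; rewrite -yx dvdn_mull.
  by have := X0 _ Xy; rewrite -yx /posnat /=; nia.
by exists x.
Qed.

Lemma Besicovitch_tautification (R : realType) B : B `<=` posnat ->
  Besicovitch R (tautification R B) <-> Besicovitch R (B `|` Behrend_dilators R B).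
Proof.
move=> B0; apply: Besicovitch_congr => n _; apply: mult_primitive_part.
by move=> x [/B0|[]].
Qed.

Lemma Besicovitch_star (R : realType) B : B `<=` posnat ->
  Besicovitch R (star B) <-> Besicovitch R (B `|` coprime_dilators B).
Proof.
move=> B0; apply: Besicovitch_congr => n _; apply: mult_primitive_part.
by move=> x [/B0|[]].
Qed.

Lemma mult1 B n : B 1%N -> mult B n.
Proof. by move=> B1; exists 1%N. Qed.

Lemma Besicovitch1 (R : realType) B : B 1%N -> Besicovitch R B.
Proof.
move=> B1; apply/BesicovitchE; exists 1; apply: cvg_near_cst.
exists 1%N => // n /= n0.
rewrite (_ : cnt R _ _ = n%:R); first by rewrite divff// pnatr_eq0; lia.
by rewrite -cntT; apply: eq_wsum => k _; split=> // _; exact: mult1.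
Qed.

(** The rate [r] may vary with [e]; eventually all ratios are within [e] of it, so they form a
    Cauchy sequence. *)
Lemma density_approx (R : realType) X :
  (forall e : R, 0 < e -> exists r C : R,
     forall n, `|cnt R X n - r * n%:R| <= e * n%:R + C) ->
  exists d : R, (cnt R X n / n%:R) @[n --> \oo] --> d.
Proof.
move=> h; apply/cvg_ex; apply/cauchy_cvgP; apply: cauchy_exP => e e0.
have e2 : 0 < e / 2 by rewrite divr_gt0.
have [r [C rC]] := h _ e2; exists r.
have b0 : 0 <= 2 * `|C| / e by rewrite divr_ge0// ?mulr_ge0// ltW.
exists (Num.bound (2 * `|C| / e)).+1 => // n /= nC.
have nR : 2 * `|C| / e < n%:R.
  by rewrite (lt_le_trans (archi_boundP b0))// ler_nat ltnW.
have n0 : 0 < n%:R :> R by rewrite (le_lt_trans b0).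
rewrite /ball /= distrC -(ltr_pM2r n0).
have -> : `|cnt R X n / n%:R - r| * n%:R = `|cnt R X n - r * n%:R|.
  rewrite -[X in _ * X = _](gtr0_norm n0) -normrM; congr (`|_|).
  by field; rewrite gt_eqF.
apply: (le_lt_trans (rC n)).
have : 2 * `|C| < n%:R * e by rewrite -ltr_pdivrMr.
have := ler_norm C; lra.
Qed.

Lemma not_Besicovitch_osc (R : realType) B (a b : R) : a < b ->
  (forall n0, exists2 n, (n0 < n)%N & cnt R (mult B) n <= a * n%:R) ->
  (forall n0, exists2 n, (n0 < n)%N & b * n%:R <= cnt R (mult B) n) ->
  ~ Besicovitch R B.
Proof.
move=> ab ha hb /BesicovitchE[d /cvgrPdist_lt hd].
have e0 : 0 < (b - a) / 2 by lra.
have [N _ hN] := hd _ e0.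
have [n Nn an] := ha N; have [m Nm bm] := hb N.
have := hN n (ltnW Nn); have := hN m (ltnW Nm).
have n0 : 0 < n%:R :> R by rewrite ltr0n; lia.
have m0 : 0 < m%:R :> R by rewrite ltr0n; lia.
have {}an : cnt R (mult B) n / n%:R <= a by rewrite ler_pdivrMr.
have {}bm : b <= cnt R (mult B) m / m%:R by rewrite ler_pdivlMr.
rewrite !ltr_norml => /andP[? ?] /andP[? ?]; lra.
Qed.

(** * Construction of the blocks *)

Definition block (k : bool) (T : nat) (g : set nat) : set nat :=
  [set d | (T < d <= T.*2)%N /\ (g d \/ (k /\ d = T.+1))].

(** Below [1/16], at most [T/8] plus a constant of the integers up to [2 T] are exceptions, so
    [3/4 T] good ones remain in [(T, 2 T]] for large [T]. Strictness leaves room for the next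
    filter. *)
Definition sparse_exceptions (R : realType) (g : set nat) :=
  exists b C : R, b < 16^-1 /\ forall n, cnt R (~` g) n <= b * n%:R + C.

Lemma cnt_initial (R : realType) T n : cnt R [set k | (k <= T)%N] n <= T%:R.
Proof.
have [/leq_trans nT|/ltnW Tn] := leqP n T.
  by apply: le_trans (cnt_le R _ _) _; rewrite ler_nat nT.
rewrite -(subnK Tn); elim: (n - T)%N => [|j IH]; first exact: cnt_le.
rewrite addSn /cnt wsumS ifN ?addr0//; apply/negP => /set_mem /=; lia.
Qed.

Lemma stage_exists (R : realType) (k : bool) (g0 : set nat) (e x : R) (m t : nat) :
  sparse_exceptions R g0 -> 0 < e -> (0 < t)%N ->
  exists (T : nat) (g : set nat) (K : R),
    [/\ (t < T)%N /\ (t %| T)%N, 0 <= K /\ x <= lsum R setT T,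
        sparse_exceptions R g /\ g `<=` g0,
        3 / 4 * T%:R <= cnt R (block k T g) T.*2 /\
        (forall n, cnt R (mult (block k T g)) n <= e * n%:R + K) &
        exists P : seq nat, (forall p, p \in P -> prime p /\ (m < p)%N) /\
          forall d, g d -> exists2 p, p \in P & (p %| d)%N].
Proof.
move=> [b [C [b16 bC]]] e0 t0.
(* Half of [e] is kept for the multiples of [T.+1], and half of the gap below [1/16] for later
   stages. *)
pose e' := Num.min (e / 2) ((16^-1 - b) / 2).
have e'0 : 0 < e' by rewrite lt_min; apply/andP; split; lra.
have e'e : e' <= e / 2 by rewrite ge_min lexx.
have e'b : e' <= (16^-1 - b) / 2 by rewrite ge_min lexx orbT.
clearbody e'.
have [P [g1 [K1 [Pm g1P cg1 mg1]]]] := prime_filter_exists m e'0.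
pose g := g0 `&` g1.
have cg n : cnt R (~` g) n <= (b + e') * n%:R + (C + K1).
  apply: (@le_trans _ _ (cnt R (~` g0) n + cnt R (~` g1) n)).
    by apply: wsum_leU => // d _; rewrite /g setCI.
  have := bC n; have := cg1 n; lra.
have [n0 hn0] := harm_unbounded x.
have [N1 hN1] : exists N : nat, 8 * (C + K1) <= N%:R.
  exists (Num.bound `|8 * (C + K1)|); apply/ltW.
  by apply: le_lt_trans (archi_boundP (normr_ge0 _)); exact: ler_norm.
have [N2 hN2] : exists N : nat, 2 / e <= N%:R.
  by exists (Num.bound (2 / e)); apply/ltW/archi_boundP; rewrite divr_ge0// ltW.
(* [n0] secures the harmonic bound [x], [N1] absorbs the constant error into [T / 8], and [N2] makes
   [1 / T.+1] at most [e / 2]. *)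
pose T := (t * (n0 + N1 + N2 + 2))%N.
have [Tn0 TN1 TN2 tT] : [/\ (n0 <= T)%N, (N1 <= T)%N, (N2 <= T)%N & (t < T)%N].
  by rewrite /T; split; nia.
have tdT : (t %| T)%N by rewrite dvdn_mulr.
clearbody T; have T0 : (0 < T)%N by lia.
have F1 d : block false T g d -> (T < d <= T.*2)%N /\ g1 d by case=> dT [[_ g1d]|[]].
have [K' hK'] := mg1 T _ F1.
exists T, g, `|K'|; split.
- by [].
- by split=> //; exact: hn0.
- split; last by move=> d [].
  by exists (b + e'), (C + K1); split=> //; lra.
- split=> [|n].
    have h : cnt R setT T.*2 <= cnt R [set d | (d <= T)%N] T.*2 +
        (cnt R (block k T g) T.*2 + cnt R (~` g) T.*2).
      apply: le_trans (_ : cnt R [set d | (d <= T)%N] T.*2 +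
          cnt R (block k T g `|` ~` g) T.*2 <= _); last first.
        by rewrite lerD2l; apply: wsum_leU.
      apply: wsum_leU => // d /andP[_ dT] _.
      have [|Td] := leqP d T; [by left|right].
      have [gd|ngd] := pselect (g d); [left|by right].
      by split; [rewrite Td|left].
    have := cnt_initial R T T.*2; have := cg T.*2.
    have TN : 8 * (C + K1) <= T%:R by rewrite (le_trans hN1)// ler_nat.
    have T0R : 0 < T%:R :> R by rewrite ltr0n.
    move: h; rewrite cntT -muln2 natrM => h1 h2 h3.
    have : (b + e') * (T%:R * 2) <= 16^-1 * (T%:R * 2).
      by rewrite ler_wpM2r ?mulr_ge0 ?(ltW T0R)//; lra.
    lra.
  have h : cnt R (mult (block k T g)) n <=
      cnt R (mult (block false T g)) n + cnt R [set j | (T.+1 %| j)%N] n.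
    apply: wsum_leU => // j _ [d [dT [gd|[_ ->]]] dj]; [left|by right].
    by exists d => //; split=> //; left.
  have := hK' n; have := @cnt_dvd_le R T.+1 n isT; have := ler_norm K'.
  have : n%:R / T.+1%:R <= e / 2 * n%:R.
    rewrite mulrC ler_wpM2r// -[e / 2]invrK lef_pV2 ?posrE ?ltr0n// ?invr_gt0 ?divr_gt0//.
    by rewrite invf_div (le_trans hN2)// ler_nat ltnW.
  have : e' * n%:R <= e / 2 * n%:R by rewrite ler_wpM2r.
  move: h; rewrite -/(block k T g).
  move: (cnt _ _ _) (cnt _ _ _) (cnt _ _ _) (n%:R / _) => a1 a2 a3 a4; lra.
by exists P; split=> // d [_ /g1P].
Qed.

(* The factorial conditions make the blocks of index [> i] negligible relative to
   the residue classes modulo [(2 T_i)`!]; with [k = true], each block also contains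
   [T_i + 1], which is coprime to all smaller blocks. *)
Record block_system (R : realType) (k : bool) := BlockSystem {
  scale : nat -> nat;
  good : nat -> set nat;
  bdens : nat -> R;
  berr : nat -> R;
  scale_gt0 : forall i, (0 < scale i)%N;
  scale_lt : forall i, ((scale i).*2 < scale i.+1)%N;
  fact_dvd_scale : forall i, ((scale i).*2`! %| scale i.+1)%N;
  bdens_gt0 : forall i, 0 < bdens i;
  bdens_le : bdens 0 <= 16^-1;
  bdens_half : forall i, bdens i.+1 <= bdens i / 2;
  bdens_fact : forall i, bdens i.+1 * ((scale i).*2.+1)`!%:R <= 16^-1;
  berr_ge0 : forall i, 0 <= berr i;
  berr_le : forall i, berr i <= bdens i * lsum R setT (scale i.+1);
  block_card : forall i, 3 / 4 * (scale i)%:R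
    <= cnt R (block k (scale i) (good i)) (scale i).*2;
  block_mult : forall i n,
    cnt R (mult (block k (scale i) (good i))) n <= bdens i * n%:R + berr i;
  good_decr : forall i, good i.+1 `<=` good i;
  good_prime : forall i, exists P : seq nat,
    (forall p, p \in P -> prime p /\ (scale i < p)%N) /\
    forall d, good i.+1 d -> exists2 p, p \in P & (p %| d)%N }.

(** Dependent choice over stages. The error [K] of a stage is known only after its scale is fixed,
    so the next scale [T'] is made large enough to absorb it. *)
Lemma block_system_exists (R : realType) (k : bool) : inhabited (block_system R k).
Proof.
pose X := (nat * set nat * R * R)%type.
pose Inv (x : X) := let: (T, g, e, K) := x in
  [/\ (0 < T)%N /\ 0 < e, 0 <= K, sparse_exceptions R g,
     3 / 4 * T%:R <= cnt R (block k T g) T.*2 &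
     forall n, cnt R (mult (block k T g)) n <= e * n%:R + K].
pose Step (x y : X) := let: (T, g, e, K) := x in let: (T', g', e', K') := y in
  [/\ (T.*2 < T')%N /\ (T.*2`! %| T')%N, e' <= e / 2 /\ e' * (T.*2.+1)`!%:R <= 16^-1,
      K <= e * lsum R setT T', g' `<=` g &
      exists P : seq nat, (forall p, p \in P -> prime p /\ (T < p)%N) /\
          forall d, g' d -> exists2 p, p \in P & (p %| d)%N].
have [x0 I0 x016] : exists2 x0, Inv x0 & x0.1.2 <= 16^-1.
  have s0 : sparse_exceptions R setT.
    exists 0, 0; split=> [|n]; first by rewrite invr_gt0.
    rewrite setCT mul0r addr0 le_eqVlt; apply/orP; left; apply/eqP.
    by rewrite /cnt /wsum big1// => j; rewrite inE.
  have e0 : 0 < 16^-1 :> R by rewrite invr_gt0.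
  have [T [g [K [[T0 _] [K0 _] [sg _] [? ?] _]]]] := @stage_exists R k setT 16^-1 0 0 1 s0 e0 isT.
  by exists (T, g, 16^-1, K) => //; split=> //; split=> //; lia.
have step (x : {x | Inv x}) : {y : {x | Inv x} | Step (sval x) (sval y)}.
  apply/cid; case: x => -[[[T g] e] K] [[T0 e0] K0 sg hc hm].
  pose e' := Num.min (e / 2) (16^-1 / (T.*2.+1)`!%:R).
  have e'0 : 0 < e'.
    by rewrite lt_min !divr_gt0// ?invr_gt0// ltr0n fact_gt0.
  have [T' [g' [K' [[T'0 dT] [K'0 xH] [sg' gg] [hc' hm'] hP]]]] :=
    @stage_exists R k g e' (K / e) T _ sg e'0 (fact_gt0 T.*2).
  have I' : Inv (T', g', e', K') by split=> //; split=> //; lia.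
  exists (exist _ _ I'); split=> //=.
  - split=> //; apply: leq_ltn_trans T'0.
    by case: (T.*2) => // j; rewrite factS leq_pmulr// fact_gt0.
  - split; first by rewrite ge_min lexx.
    by rewrite -ler_pdivlMr ?ltr0n ?fact_gt0// ge_min lexx orbT.
  - by rewrite mulrC -ler_pdivrMr.
have [f [f0 fS]] := dependent_choice step (exist _ x0 I0).
pose sT i := (sval (f i)).1.1.1; pose sg i := (sval (f i)).1.1.2.
pose se i := (sval (f i)).1.2; pose sK i := (sval (f i)).2.
have inv i : [/\ (0 < sT i)%N /\ 0 < se i, 0 <= sK i, sparse_exceptions R (sg i),
     3 / 4 * (sT i)%:R <= cnt R (block k (sT i) (sg i)) (sT i).*2 &
     forall n, cnt R (mult (block k (sT i) (sg i))) n <= se i * n%:R + sK i].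
  by rewrite /sT /sg /se /sK; case: (f i) => -[[[T g] e] K] /=.
have stp i : [/\ ((sT i).*2 < sT i.+1)%N /\ ((sT i).*2`! %| sT i.+1)%N,
      se i.+1 <= se i / 2 /\ se i.+1 * ((sT i).*2.+1)`!%:R <= 16^-1,
      sK i <= se i * lsum R setT (sT i.+1), sg i.+1 `<=` sg i &
      exists P : seq nat, (forall p, p \in P -> prime p /\ (sT i < p)%N) /\
          forall d, sg i.+1 d -> exists2 p, p \in P & (p %| d)%N].
  have := fS i; rewrite /sT /sg /se /sK.
  by case: (f i) => -[[[? ?] ?] ?] ?; case: (f i.+1) => -[[[? ?] ?] ?] ?.
constructor; apply: (@BlockSystem R k sT sg se sK).
- by move=> i; have [[]] := inv i.
- by move=> i; have [[]] := stp i.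
- by move=> i; have [[]] := stp i.
- by move=> i; have [[]] := inv i.
- by rewrite /se f0.
- by move=> i; have [_ []] := stp i.
- by move=> i; have [_ []] := stp i.
- by move=> i; have [] := inv i.
- by move=> i; have [] := stp i.
- by move=> i; have [] := inv i.
- by move=> i; have [] := inv i.
- by move=> i; have [] := stp i.
- by move=> i; have [] := stp i.
Qed.

(** * Dilators of Behrend sets *)

Lemma cnt_ge1 (R : realType) (X : set nat) k n : X k -> (0 < k <= n)%N -> 1 <= cnt R X n.
Proof.
case: k => // k Xk /andP[_ kn].
apply: (@le_trans _ _ (cnt R X k.+1)); last exact: wsum_le_leq.
by rewrite /cnt wsumS mem_set// lerDr; apply: wsum_ge0.
Qed.

Lemma ln_unbounded (R : realType) (x : R) :
  exists n0, forall n, (n0 <= n)%N -> x <= ln n%:R.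
Proof.
have [n0 h] := harm_unbounded (1 + x); exists n0.+1 => n n0n.
have n0' : (0 < n)%N by lia.
by have /andP[_] := harm_bounds R n0'; have := h n (ltnW n0n); lra.
Qed.

(* If [c] is not a multiple of [S], the class [c mod c Q] avoids the multiples of the
   elements of [S] dividing [Q]; it has log density [1 / (c Q)], more than [U] and
   the complement of [c (mult A)] together can cover. *)
Lemma Behrend_dilators_sub (R : realType) (S B : set nat) :
  (forall c, (0 < c)%N -> exists (Q : nat) (U : set nat) (eta : R),
    [/\ (0 < Q)%N, forall s, S s -> (s %| Q)%N \/ U s, eta * (c * Q)%:R < 1 &
        forall n0, exists2 n, (n0 <= n)%N &
          lsum R (mult U) n <= eta * lsum R setT n]) ->
  B `<=` mult S -> Behrend_dilators R B `<=` mult S.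
Proof.
move=> hS BS c [c0 [A [[_ +] cAB]]]; rewrite is_log_densityE => /cvgrPdist_lt hA.
apply: contrapT => ncS; have [Q [U [eta [Q0 SQU etaQ hU]]]] := hS c c0.
pose q := (c * Q)%N; have q0 : (0 < q)%N by rewrite muln_gt0 c0.
have q0R : 0 < q%:R :> R by rewrite ltr0n.
pose W : set nat := [set k | k = c %[mod q]].
have cW n : q%:R^-1 * n%:R - q%:R <= cnt R W n.
  have per k : (0 < k)%N -> W (k + q)%N <-> W k by move=> _; rewrite /W /= modnDr.
  have := @cnt_periodic R q W n q0 per.
  have : 1 <= cnt R W q by apply: (@cnt_ge1 _ _ c) => //; rewrite c0 leq_pmulr.
  rewrite ler_norml => h1 /andP[h2 _].
  have : q%:R^-1 * n%:R <= cnt R W q / q%:R * n%:R.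
    by rewrite ler_wpM2r// ler_pdivlMr// mulVf ?gt_eqF.
  by lra.
have hW n := @lsum_ge_cnt R q%:R^-1 q%:R W n (ltW q0R) cW.
have WU n : lsum R W n <=
    lsum R (mult U) n + c%:R^-1 * (lsum R setT n - lsum R (mult A) n).
  apply: (@le_trans _ _ (lsum R (mult U) n + lsum R (dilate c (~` mult A)) n)).
    apply: wsum_leU => k; rewrite ?inv_nat_ge0// => _ Wk.
    have /dvdnP[j jE] : (c %| k)%N.
      by rewrite /dvdn -(modn_dvdm k (dvdn_mulr Q (dvdnn c))) Wk modn_dvdm ?dvdn_mulr// modnn.
    (* Since [c * j] is congruent to [c] modulo [c * Q], [j] is congruent to 1 modulo [Q]. *)
    have jQ : coprime Q j.
      rewrite coprime_sym -coprime_modl; suff -> : (j %% Q = 1 %% Q)%N.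
        by rewrite coprime_modl coprime1n.
      by apply/eqP; rewrite -(eqn_pmul2l c0) !muln_modr muln1 [(c * j)%N]mulnC -jE; apply/eqP.
    have [[a Aa aj]|nA] := pselect (mult A j); [left|right]; last first.
      by exists j; rewrite // mulnC.
    have [s Ss sca] : mult S (c * a)%N by apply/BS/cAB; exists a.
    have scj : (s %| c * j)%N by apply: dvdn_trans sca _; rewrite dvdn_pmul2l.
    have [sQ|Us] := SQU s Ss; last by exists s => //; rewrite jE mulnC.
    exfalso; apply: ncS; exists s => //.
    by rewrite Gauss_dvdl in scj => //; exact: coprime_dvdl jQ.
  by rewrite lerD2l -wsumC; exact: lsum_dilate_le.
(* A quarter of the gap: the error [q + 1 + dl * ln n] is at most [2 * dl * ln n] for large [n],
   short of the gap [4 * dl] times the harmonic sum. *)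
pose dl := (q%:R^-1 - eta) / 4.
have dl0 : 0 < dl.
  rewrite divr_gt0// subr_gt0 -(ltr_pM2r q0R) mulVf ?gt_eqF//.
have [N1 _ hN1] := hA _ dl0.
have [N2 hN2] := ln_unbounded (((q%:R + 1) / dl : R)).
have [n + hn] := hU (N1 + N2 + 2)%N => nN.
have n0 : (0 < n)%N by lia.
have /andP[h1 h2] := harm_bounds R n0.
have h3 : (q%:R + 1) / dl <= ln n%:R by apply: hN2; lia.
have l0 : 0 < ln (n%:R : R) by rewrite ln_gt0// ltr1n; lia.
have h4 : (1 - dl) * ln n%:R <= lsum R (mult A) n.
  have /= := hN1 n _; rewrite ltr_norml => /(_ ltac:(lia))/andP[_ h].
  by rewrite -ler_pdivlMr// ltW//; lra.
move: h3; rewrite ler_pdivrMr// => h3.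
have h5 := WU n; have h6 := hW n.
have h7 : lsum R setT n - lsum R (mult A) n <= 1 + dl * ln n%:R by lra.
have h8 : c%:R^-1 * (lsum R setT n - lsum R (mult A) n) <= 1 + dl * ln n%:R.
  apply: le_trans (_ : c%:R^-1 * (1 + dl * ln n%:R) <= _).
    by rewrite ler_wpM2l ?inv_nat_ge0.
  have ? : 0 <= 1 + dl * ln n%:R by rewrite addr_ge0// mulr_ge0// ltW.
  rewrite -[leRHS]mul1r ler_wpM2r//.
  by rewrite invf_le1 ?ltr0n// ler1n.
have h9 : 4 * dl * lsum R setT n <= q%:R + 1 + dl * ln n%:R.
  rewrite /dl in h8 *; lra.
have : dl * ln n%:R <= dl * lsum R setT n by rewrite ler_wpM2l// ltW.
have : 0 < dl * ln n%:R by rewrite mulr_gt0.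
lra.
Qed.

(** Only integers up to [N] can be missed; they contribute at most [N] to a harmonic sum that grows
    like [ln n]. *)
Lemma Behrend_tail (R : realType) N : (0 < N)%N -> Behrend R [set m | (N < m)%N].
Proof.
move=> N0; split=> [m /= Nm|].
  by split; rewrite /posnat /=; lia.
rewrite is_log_densityE; apply/cvgrPdist_lt => e e0.
have [n0 h0] := @ln_unbounded R ((N%:R + 2) / e); exists (n0 + 2)%N => // n /= nn.
have l0 : 0 < ln (n%:R : R) by rewrite ln_gt0// ltr1n; lia.
have /h0 : (n0 <= n)%N by lia.
have n1 : (0 < n)%N by lia.
rewrite ler_pdivrMr// => h1; have /andP[h2 h3] := harm_bounds R n1.
have h4 : lsum R setT n <= lsum R (mult [set m | (N < m)%N]) n + N%:R.
  apply: (@le_trans _ _ (lsum R (mult [set m | (N < m)%N]) n +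
                         lsum R [set k | (k <= N)%N] n)).
    apply: wsum_leU => k; rewrite ?inv_nat_ge0// => _ _.
    by have [|Nk] := leqP k N; [right|left; exact: sub_mult].
  rewrite lerD2l; apply: le_trans (cnt_initial R N n); rewrite /lsum /cnt !wsum_cond.
  apply: ler_sum_nat => k /andP[k0 _]; rewrite ler_wpM2l// invf_le1 ?ltr0n// ler1n//.
have h5 : lsum R (mult [set m | (N < m)%N]) n <= lsum R setT n.
  by apply: wsum_le => // k; rewrite inv_nat_ge0.
have -> : 1 - lsum R (mult [set m | (N < m)%N]) n / ln n%:R =
  (ln n%:R - lsum R (mult [set m | (N < m)%N]) n) / ln n%:R.
  by rewrite mulrBl divff// gt_eqF.
rewrite normrM normfV (gtr0_norm l0) ltr_pdivrMr// ltr_norml.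
have N0R : 0 <= N%:R :> R by [].
apply/andP; split; lra.
Qed.

Lemma dvd_lsum_le (R : realType) p n : (0 < p)%N ->
  lsum R [set k | (p %| k)%N] n <= p%:R^-1 * lsum R setT n.
Proof.
move=> p0; apply: le_trans (lsum_dilate_le R setT n p0).
apply: wsum_le => k; rewrite ?inv_nat_ge0// => _ /dvdnP[j ->].
by exists j; rewrite // mulnC.
Qed.

(** * The union of the blocks *)

Definition nth_block (R : realType) k (S : block_system R k) (i : nat) : set nat :=
  block k (scale S i) (good S i).

Definition tail_blocks (R : realType) k (S : block_system R k) (N : nat) : set nat :=
  [set d | exists2 i, (N <= i)%N & nth_block S i d].

Definition blocks (R : realType) k (S : block_system R k) : set nat :=
  tail_blocks S 0.

Lemma scale_ltn (R : realType) k (S : block_system R k) i j :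
  (i < j)%N -> ((scale S i).*2 < scale S j)%N.
Proof.
elim: j => // j IH; rewrite ltnS leq_eqVlt => /predU1P[->|/IH h].
  exact: scale_lt.
by have := scale_lt S j; lia.
Qed.

Lemma scale_leq (R : realType) k (S : block_system R k) i j :
  (i <= j)%N -> (scale S i <= scale S j)%N.
Proof. by rewrite leq_eqVlt => /predU1P[->//|/(scale_ltn S)]; lia. Qed.

Lemma ltn_scale (R : realType) k (S : block_system R k) i : (i < scale S i)%N.
Proof. by elim: i => [|i IH]; [exact: scale_gt0|have := scale_lt S i; lia]. Qed.

Lemma blocks_gt0 (R : realType) k (S : block_system R k) : blocks S `<=` posnat.
Proof. by move=> d [i _ [/andP[+ _] _]]; exact: leq_trans. Qed.

Lemma bdens_geo (R : realType) k (S : block_system R k) N M :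
  \sum_(N <= i < M) bdens S i <= 2 * bdens S N.
Proof.
have [MN|NM] := leqP M N; first by rewrite big_geq// mulr_ge0// ltW// bdens_gt0.
suff : \sum_(N <= i < M) bdens S i + 2 * bdens S M <= 2 * bdens S N.
  by apply: le_trans; rewrite lerDl mulr_ge0// ltW// bdens_gt0.
elim: M NM => // M IH; rewrite ltnS leq_eqVlt => /predU1P[<-|NM].
  by rewrite big_nat1; have := bdens_half S N; lra.
by rewrite (big_nat_recr _ _ _ (ltnW NM))/=; have := IH NM; have := bdens_half S M; lra.
Qed.

Lemma harm_le (R : realType) m n : (m <= n)%N -> lsum R setT m <= lsum R setT n.
Proof. by apply: wsum_le_leq => k; rewrite inv_nat_ge0. Qed.

Lemma harm_le_nat (R : realType) n : lsum R setT n <= n%:R.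
Proof.
rewrite -[leRHS]cntT /lsum /cnt !wsum_cond; apply: ler_sum_nat => k /andP[k0 _].
by rewrite ler_wpM2l// invf_le1 ?ltr0n// ler1n.
Qed.

(** From the next scale on, [berr_le] makes the error no larger than the main term, whence the
    factor 2. *)
Lemma lsum_block_le (R : realType) k (S : block_system R k) i n :
  (scale S i.+1 <= n)%N ->
  lsum R (mult (nth_block S i)) n <= 2 * bdens S i * lsum R setT n.
Proof.
move=> sn; have := lsum_le_cnt n (berr_ge0 S i) (block_mult S i).
have := berr_le S i.
have : bdens S i * lsum R setT (scale S i.+1) <= bdens S i * lsum R setT n.
  by rewrite ler_wpM2l ?harm_le// ltW// bdens_gt0.
by rewrite /nth_block; lra.
Qed.

Lemma cnt_block_le (R : realType) k (S : block_system R k) i n :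
  (scale S i.+1 <= n)%N ->
  cnt R (mult (nth_block S i)) n <= 2 * bdens S i * n%:R.
Proof.
move=> sn; have := block_mult S i n; have := berr_le S i.
have : bdens S i * lsum R setT (scale S i.+1) <= bdens S i * n%:R.
  by rewrite ler_wpM2l ?(le_trans (harm_le R sn)) ?harm_le_nat// ltW// bdens_gt0.
by rewrite /nth_block; lra.
Qed.

(** Up to [scale S j] only blocks of index below [j] have multiples, and each of these is already in
    the range of its bound. The geometric sum of the [bdens] doubles the factor 2. *)
Lemma wsum_tail_le (R : realType) k (S : block_system R k) (w : nat -> R) (h : nat -> R)
    N j : (forall i, 0 <= w i) -> (forall n, 0 <= h n) ->
  (forall i n, (scale S i.+1 <= n)%N ->
     wsum w (mult (nth_block S i)) n <= 2 * bdens S i * h n) ->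
  wsum w (mult (tail_blocks S N)) (scale S j) <= 4 * bdens S N * h (scale S j).
Proof.
move=> w0 h0 hw.
apply: (@le_trans _ _ (\sum_(i <- index_iota N j) wsum w (mult (nth_block S i)) (scale S j))).
  apply: wsum_le_bigU => // d /andP[d0 dj] [b [i Ni Fb] bd]; exists i; last by exists b.
  rewrite mem_index_iota Ni /= ltnNge; apply/negP => ji.
  have := scale_leq S ji; have := dvdn_leq d0 bd; move: Fb => [/andP[+ _] _]; lia.
apply: (@le_trans _ _ (\sum_(i <- index_iota N j) 2 * h (scale S j) * bdens S i)).
  rewrite big_seq [leRHS]big_seq ler_sum// => i; rewrite mem_index_iota => /andP[_ ij].
  by rewrite mulrAC hw// scale_leq.
rewrite -mulr_sumr; have := bdens_geo S N j.
move=> /(ler_wpM2l (_ : 0 <= 2 * h (scale S j))) h1.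
by apply: le_trans (h1 _) _; [rewrite mulr_ge0|lra].
Qed.

Lemma lsum_tail_le (R : realType) k (S : block_system R k) N j :
  lsum R (mult (tail_blocks S N)) (scale S j)
    <= 4 * bdens S N * lsum R setT (scale S j).
Proof.
apply: (@wsum_tail_le R k S _ (lsum R setT)) => [i|n|i n].
- by rewrite inv_nat_ge0.
- by apply: wsum_ge0 => i; rewrite inv_nat_ge0.
- exact: lsum_block_le.
Qed.

Lemma cnt_tail_le (R : realType) k (S : block_system R k) N j :
  cnt R (mult (tail_blocks S N)) (scale S j) <= 4 * bdens S N * (scale S j)%:R.
Proof.
apply: (@wsum_tail_le R k S _ (fun n => n%:R)) => // i n; exact: cnt_block_le.
Qed.

(** At a scale the proportion is at most [4 / 16]; at twice the scale the block alone supplies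
    [3/4 T] out of [2 T]. *)
Lemma blocks_not_Besicovitch (R : realType) k (S : block_system R k) :
  ~ Besicovitch R (blocks S).
Proof.
apply: (@not_Besicovitch_osc R _ (1 / 4) (3 / 8)) => [|n0|n0]; first lra.
- exists (scale S n0); first exact: ltn_scale.
  apply: le_trans (cnt_tail_le S 0 n0) _; rewrite ler_wpM2r//.
  by have := bdens_le S; lra.
- exists (scale S n0).*2; first by have := ltn_scale S n0; lia.
  apply: le_trans (_ : 3 / 4 * (scale S n0)%:R <= _).
    by rewrite -muln2 natrM; lra.
  apply: (le_trans (block_card S n0)); apply: wsum_le => // d _ Fd.
  by apply: sub_mult; exists n0.
Qed.

(** All elements of the blocks up to index [c] divide [Q = (2 T_c)!]. As [c < T_c], [c * Q] is at
    most [(2 T_c + 1)!], against which [bdens_fact] makes the tail small. *)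
Lemma Behrend_dilators_blocks (R : realType) k (S : block_system R k) B :
  B `<=` mult (blocks S) -> Behrend_dilators R B `<=` mult (blocks S).
Proof.
apply: Behrend_dilators_sub => c c0.
exists (scale S c).*2`!, (tail_blocks S c.+1), (4 * bdens S c.+1); split.
- exact: fact_gt0.
- move=> s [i _ Fs]; have [ic|ci] := leqP i c; [left|by right; exists i].
  apply: dvdn_fact; case: Fs => /andP[s1 s2] _; have := scale_leq S ic; lia.
- have cS : (c * (scale S c).*2`! <= (scale S c).*2.+1`!)%N.
    by rewrite factS leq_mul2r; apply/orP; right; have := ltn_scale S c; lia.
  apply: (@le_lt_trans _ _ (4 * bdens S c.+1 * (scale S c).*2.+1`!%:R)).
    by rewrite ler_wpM2l ?ler_nat// mulr_ge0// ltW// bdens_gt0.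
  by have := bdens_fact S c; lra.
- move=> n0; exists (scale S n0); first by apply: ltnW; exact: ltn_scale.
  exact: lsum_tail_le.
Qed.

Lemma finite_subsingleton (A : set nat) :
  (forall a b, A a -> A b -> a = b) -> finite_set A.
Proof.
move=> h; have [[a Aa]|nA] := pselect (exists a, A a).
  by apply: (@sub_finite_set _ _ [set a]) => [b Ab /=|]; [exact: h|exact: finite_set1].
by apply: (@sub_finite_set _ _ set0) => [b Ab|]; [apply: nA; exists b|exact: finite_set0].
Qed.

Lemma good_le (R : realType) k (S : block_system R k) i j :
  (i <= j)%N -> good S j `<=` good S i.
Proof. by move=> /subnK <-; elim: (j - i)%N => // n IH d /good_decr/IH. Qed.

(* Elements of late blocks have a prime factor in a fixed finite set of primes
   exceeding [d]; only finitely many terms of a pairwise coprime family can. *)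
Lemma coprime_dilators_blocks (R : realType) (S : block_system R false) B :
  B `<=` mult (blocks S) -> coprime_dilators B `<=` mult (blocks S).
Proof.
move=> BS d [d0 [A [A0 infA coA dAB]]]; apply: contrapT => nd; apply: infA.
have [P [Pd gP]] := good_prime S d.
pose G1 p : set nat := [set a | A a /\ (p %| a)%N].
pose G2 e : set nat := [set a | [/\ A a, blocks S e & (e %| d * a)%N]].
have fin1 p : p \in P -> finite_set (G1 p).
  move=> /Pd[pp _]; apply: finite_subsingleton => a b [Aa pa] [Ab pb].
  apply: contrapT => ab; have := coA a b Aa Ab ab.
  rewrite /coprime => /eqP ab1; have : (p %| gcdn a b)%N by rewrite dvdn_gcd pa.
  by rewrite ab1 dvdn1 => /eqP p1; move: pp; rewrite p1.
have fin2 e : finite_set (G2 e).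
  apply: finite_subsingleton => a b [Aa Ee ea] [Ab _ eb].
  apply: contrapT => ab; have := coA a b Aa Ab ab.
  rewrite /coprime => /eqP ab1; apply: nd; exists e => //.
  (* With [a] and [b] coprime this gcd is [d], so [d] would be a multiple of [e]. *)
  have : (e %| gcdn (d * a) (d * b))%N by rewrite dvdn_gcd ea.
  by rewrite -muln_gcdr ab1 muln1.
apply: (@sub_finite_set _ _ (\bigcup_(p in [set` P]) G1 p `|`
    \bigcup_(e in `I_(scale S d).*2.+1) G2 e)); last first.
  rewrite finite_setU; split; apply: bigcup_finite => //.
(* An [e] from a block of index at most [d] is one of finitely many; a later one has a prime factor
   in [P], larger than [d], which must divide [a]. *)
move=> a Aa; have [e Ee ea] : mult (blocks S) (d * a)%N by apply/BS/dAB; exists a.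
have [i _ [/andP[ie ei] gd]] := Ee; have [id|di] := leqP i d.
  by right; exists e => //=; rewrite ltnS (leq_trans ei)// leq_double scale_leq.
left; have [p pP pe] : exists2 p, p \in P & (p %| e)%N.
  by apply: gP; apply: (good_le di); case: gd => // -[].
exists p => //; split=> //; have [pp dp] := Pd p pP.
have : (p %| d * a)%N by exact: dvdn_trans ea.
rewrite Euclid_dvdM// => /orP[/(dvdn_leq d0)|//].
by have := ltn_scale S d; lia.
Qed.

(** * Far multiples and thin multiples *)

Lemma Besicovitch_sandwich (R : realType) X E :
  X `<=` mult E -> E `<=` mult X -> Besicovitch R X <-> Besicovitch R E.
Proof. by move=> XE EX; apply: Besicovitch_congr => n _; split; exact: mult_idem. Qed.

Lemma infinite_unbounded (A : set nat) :
  (forall n, exists2 a, A a & (n < a)%N) -> infinite_set A.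
Proof.
move=> h /finite_seqP[s sA]; have [a] := h (\max_(i <- s) i); rewrite sA /= => as_.
by rewrite ltnNge => /negP; apply; exact: leq_bigmax_seq.
Qed.

Lemma coprime_dilators_primes B d N : posnat d ->
  (forall p, prime p -> (N < p)%N -> B (d * p)%N) -> coprime_dilators B d.
Proof.
move=> d0 h; split=> //; exists [set p | prime p /\ (N < p)%N]; split.
- by move=> p [/prime_gt0].
- apply: infinite_unbounded => n; have [p np pp] := prime_above (n + N).
  by exists p; [split=> //; lia|lia].
- move=> p q [pp _] [qp _] /eqP pq; rewrite prime_coprime// dvdn_prime2//.
- by move=> b [p [pp Np] <-]; exact: h.
Qed.

(** [T_i + 1] is at most [2 T_(j-1)], so it divides [(2 T_(j-1))!] and hence [T_j]. *)
Lemma coprime_scaleS (R : realType) k (S : block_system R k) i j :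
  (i < j)%N -> coprime (scale S i).+1 (scale S j).+1.
Proof.
case: j => // j; rewrite ltnS => ij.
apply: (@coprime_dvdl _ (scale S j.+1)); last exact: coprimenS.
apply: dvdn_trans (fact_dvd_scale S j); apply: dvdn_fact.
by have := scale_leq S ij; have := scale_gt0 S i; lia.
Qed.

(** Exponent 1 serves [blocks]; large exponents serve [far_multiples], where the cofactor must
    exceed the next scale. *)
Lemma coprime_dilators1 (R : realType) k (S : block_system R k) (t : nat -> nat) B :
  (forall i, B ((scale S i).+1 ^ (t i).+1)%N) -> coprime_dilators B 1.
Proof.
move=> hB; split=> //; exists (range (fun i => (scale S i).+1 ^ (t i).+1)%N); split.
- by move=> _ [i _ <-]; rewrite /posnat /= expn_gt0.
- apply: infinite_unbounded => n; eexists; first by exists n.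
  apply: (@leq_trans ((scale S n).+1 ^ 1)%N); last first.
    by rewrite leq_exp2l//; have := scale_gt0 S n; lia.
  by rewrite expn1 ltnS ltnW// ltn_scale.
- move=> _ _ [i _ <-] [j _ <-] ij.
  have {}ij : i <> j by move=> ij'; apply: ij; rewrite ij'.
  by rewrite coprimeXl// coprimeXr//; case: (ltngtP i j) => // h;
    [|rewrite coprime_sym]; exact: coprime_scaleS.
- by move=> _ [_ [i _ <-] <-]; rewrite mul1n.
Qed.

Definition far_block (R : realType) k (S : block_system R k) i : set nat :=
  [set b | exists e m, [/\ nth_block S i e, (scale S i.+1 < m)%N & b = e * m]%N].

Definition far_multiples (R : realType) k (S : block_system R k) : set nat :=
  \bigcup_i far_block S i.

Lemma far_multiples_sub (R : realType) k (S : block_system R k) :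
  far_multiples S `<=` mult (blocks S).
Proof.
move=> _ [i _ [e [m [Fe _ ->]]]]; exists e; last exact: dvdn_mulr.
by exists i.
Qed.

Lemma far_multiples_gt0 (R : realType) k (S : block_system R k) :
  far_multiples S `<=` posnat.
Proof.
move=> _ [i _ [e [m [Fe sm ->]]]]; rewrite /posnat /= muln_gt0; apply/andP; split; last by lia.
by apply: (@blocks_gt0 _ _ S); exists i.
Qed.

Lemma far_block_mult (R : realType) k (S : block_system R k) i n :
  (0 < n)%N -> mult (far_block S i) n -> far_block S i n.
Proof.
move=> n0 [_ [e [m [Fe sm ->]]] /dvdnP[j nE]]; exists e, (m * j)%N; split=> //.
  by apply: (leq_trans sm); rewrite leq_pmulr//; move: n0; rewrite nE; case: j {nE}.
by rewrite nE; lia.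
Qed.

(** Elements exceed the next scale, so below it there is nothing to count and beyond it the block
    bound applies. Holding at every [n], the estimate rules out the oscillation of [blocks]. *)
Lemma cnt_far_block (R : realType) k (S : block_system R k) i n :
  cnt R (far_block S i) n <= 2 * bdens S i * n%:R.
Proof.
have [sn|ns] := leqP (scale S i.+1) n.
  apply: le_trans (cnt_block_le sn); apply: wsum_le => // b _ [e [m [Fe _ ->]]].
  by exists e => //; exact: dvdn_mulr.
rewrite /cnt (@eq_wsum _ _ _ set0) => [|b /andP[b0 bn]]; last first.
  split=> // -[e [m [[/andP[se _] _] sm bE]]].
  by have : (m <= e * m)%N; [rewrite leq_pmull//; lia|lia].
rewrite /wsum big1 => [|j]; last by rewrite in_set0.
by rewrite !mulr_ge0// ltW// bdens_gt0.
Qed.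

Lemma bdens_small (R : realType) k (S : block_system R k) (e : R) : 0 < e ->
  exists N, bdens S N <= e.
Proof.
move=> e0; pose i := Num.bound e^-1; exists i.+1.
have h : e^-1 <= ((scale S i).*2.+1)`!%:R.
  have ei0 : 0 <= e^-1 by rewrite invr_ge0 ltW.
  apply: (le_trans (ltW (archi_boundP ei0))); rewrite -/i ler_nat factS.
  by have := ltn_scale S i; have := fact_gt0 (scale S i).*2; nia.
have := bdens_fact S i; have := bdens_gt0 S i.+1.
have f0 : 0 < ((scale S i).*2.+1)`!%:R :> R by rewrite ltr0n fact_gt0.
rewrite -ler_pdivlMr// => _ /le_trans; apply.
rewrite ler_pdivrMr//; apply: (@le_trans _ _ 1); first by lra.
by rewrite -ler_pdivrMl// mulr1.
Qed.

(** The multiples of the first [N] blocks are periodic. Replacing these blocks by far multiples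
    loses only integers up to [C], and the remaining far blocks have total density at most
    [4 * bdens S N <= e]. *)
Lemma far_multiples_Besicovitch (R : realType) k (S : block_system R k) :
  Besicovitch R (far_multiples S).
Proof.
apply/BesicovitchE/density_approx => e e0.
have [|N bN] := @bdens_small R k S (e / 4); first by rewrite divr_gt0.
pose Y := [set d | exists2 i, (i < N)%N & nth_block S i d].
pose q := (scale S N)`!; have q0 : (0 < q)%N by exact: fact_gt0.
have Yq b : Y b -> (b %| q)%N.
  move=> [i iN [/andP[b0 b1] _]]; apply: dvdn_fact.
  by have := scale_ltn S iN; lia.
pose C := ((scale S N) * (scale S N))%N.
exists (cnt R (mult Y) q / q%:R), (C%:R + q%:R) => n.
have := @cnt_periodic R q (mult Y) n q0 (fun j _ => mult_periodic Yq j).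
have lo : cnt R (mult Y) n <= cnt R (mult (far_multiples S)) n + C%:R.
  apply: le_trans (_ : cnt R (mult (far_multiples S)) n +
                       cnt R [set j | (j <= C)%N] n <= _).
    apply: wsum_leU => // j /andP[j0 _] [d [i iN Fd] /dvdnP[m jE]].
    have [sm|ms] := ltnP (scale S i.+1) m; [left|right].
      by exists j => //; exists i => //; exists d, m; split; rewrite // mulnC.
    have := scale_ltn S iN; have := scale_leq S iN.
    by case: Fd => /andP[_ d2] _ /= h1 h2; rewrite jE /C leq_mul//; lia.
  by rewrite lerD2l; exact: cnt_initial.
have hi : cnt R (mult (far_multiples S)) n <= cnt R (mult Y) n + e * n%:R.
  pose Z := [set b | exists2 i, (N <= i)%N & far_block S i b].
  apply: (@le_trans _ _ (cnt R (mult Y) n + cnt R Z n)).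
    apply: wsum_leU => // j /andP[j0 _] [b [i _ fb] bj].
    have [iN|Ni] := ltnP i N; [left|right].
      case: fb bj => d [m [Fd _ ->]] dj; exists d; first by exists i.
      by apply: dvdn_trans dj; exact: dvdn_mulr.
    by exists i => //; apply: far_block_mult => //; exists b.
  rewrite lerD2l.
  apply: (@le_trans _ _ (\sum_(i <- index_iota N n) cnt R (far_block S i) n)).
    apply: wsum_le_bigU => // j /andP[j0 jn] [i Ni fj]; exists i => //.
    rewrite mem_index_iota Ni /=; case: fj => d [m [[/andP[sd _] _] sm jE]].
    have : (d <= d * m)%N by rewrite leq_pmulr//; lia.
    by have := ltn_scale S i; lia.
  apply: (@le_trans _ _ (\sum_(i <- index_iota N n) 2 * n%:R * bdens S i)).
    by apply: ler_sum => i _; rewrite mulrAC cnt_far_block.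
  rewrite -mulr_sumr; have := bdens_geo S N n.
  move=> /(ler_wpM2l (_ : 0 <= 2 * n%:R)) h1.
  apply: le_trans (h1 _) _; first by rewrite mulr_ge0.
  have -> : 2 * n%:R * (2 * bdens S N) = 4 * bdens S N * n%:R by ring.
  by rewrite ler_wpM2r//; lra.
have : 0 <= e * n%:R by rewrite mulr_ge0// ltW.
have : 0 <= C%:R :> R by [].
rewrite !ler_norml => ? ? /andP[? ?]; apply/andP; split; lra.
Qed.

(* The factor [2 ^ j.+1] makes the reciprocals summable; the other one makes the tail
   after [N] smaller than [1 / (N.+1 * Q)], where [Q] is a common multiple of all
   products [e * thin i] with [e <= i <= N]. *)
Fixpoint thin (i : nat) : nat :=
  if i is j.+1 then (2 ^ j.+1 * (j.+1 * (j.+1 * thin j)`!)).+1 else 1.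

Lemma thin_gt0 i : (0 < thin i)%N. Proof. by case: i. Qed.

Lemma fact_ge n : (n <= n`!)%N.
Proof. by case: n => // n; rewrite factS leq_pmulr// fact_gt0. Qed.

Lemma thin_lt i : (i.+1 * thin i < thin i.+1)%N.
Proof.
rewrite /= ltnS mulnA; apply: (leq_trans (fact_ge _)).
by rewrite leq_pmull// muln_gt0 expn_gt0.
Qed.

Lemma thin_leq i j : (i <= j)%N -> (thin i <= thin j)%N.
Proof.
move=> /subnK <-; elim: (j - i)%N => // n IH; rewrite addSn.
by have := thin_lt (n + i); have := thin_gt0 (n + i); nia.
Qed.

Lemma ltn_thin i : (i < thin i)%N.
Proof.
elim: i => // i IH; apply: (leq_trans _ (thin_lt i)).
by have := thin_gt0 i; nia.
Qed.

Lemma coprime_thin i j : (i < j)%N -> coprime (thin i) (thin j).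
Proof.
case: j => // j; rewrite ltnS => ij; rewrite [thin j.+1]/=.
apply: (@coprime_dvdl _ (2 ^ j.+1 * (j.+1 * (j.+1 * thin j)`!))); last exact: coprimenS.
rewrite !dvdn_mull// dvdn_fact// thin_gt0 /=.
by apply: (leq_trans (thin_leq ij)); rewrite leq_pmull.
Qed.

(** This is [1 / (N.+1 * Q)] with [Q] the common multiple of [thin_dvd], so that [N * Q] times it is
    below 1, as required for the dilator [N]. *)
Definition thin_bound (R : realType) N : R := (N.+1 * (N.+1 * thin N)`!)%:R^-1.

Lemma thin_inv_le (R : realType) N i : (N <= i)%N ->
  (thin i.+1)%:R^-1 <= thin_bound R N * 2^-1 ^+ i.+1.
Proof.
move=> Ni; rewrite /thin_bound exprVn -invfM -natrX -natrM.
rewrite lef_pV2 ?posrE ?ltr0n ?muln_gt0 ?fact_gt0 ?expn_gt0//.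
rewrite ler_nat /= mulnC; apply: leqW; rewrite leq_mul2l.
apply/orP; right; apply: leq_mul => //; apply: dvdn_leq; first exact: fact_gt0.
by rewrite (fact_split (leq_mul (_ : N < i.+1)%N (thin_leq Ni))) ?dvdn_mulr.
Qed.

Lemma thin_sum_le (R : realType) N n :
  \sum_(N <= i < n) (thin i.+1)%:R^-1 <= thin_bound R N.
Proof.
have b0 : 0 <= thin_bound R N by rewrite invr_ge0.
apply: (@le_trans _ _ (thin_bound R N * \sum_(N <= i < n) 2^-1 ^+ i.+1)).
  by rewrite mulr_sumr; apply: ler_sum_nat => i /andP[Ni _]; exact: thin_inv_le.
rewrite -[leRHS]mulr1 ler_wpM2l//.
have g m : \sum_(0 <= i < m) 2^-1 ^+ i.+1 = 1 - 2^-1 ^+ m :> R.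
  elim: m => [|m IH]; first by rewrite big_geq// expr0 subrr.
  by rewrite big_nat_recr//= IH exprS; lra.
have [nN|Nn] := leqP n N; first by rewrite big_geq.
apply: (@le_trans _ _ (\sum_(0 <= i < n) 2^-1 ^+ i.+1)).
  rewrite [leRHS](@big_cat_nat _ _ _ N)//=; last exact: ltnW.
  by rewrite lerDr; apply: sumr_ge0 => i _; rewrite exprn_ge0// invr_ge0.
by rewrite g gerBl exprn_ge0// invr_ge0.
Qed.

(** The condition [e <= i] leaves finitely many products for each [i], yet each [e] keeps all but
    finitely many of the coprime factors. *)
Definition thin_part (E : set nat) (I : set nat) : set nat :=
  [set b | exists i e, [/\ I i, E e, (e <= i)%N & b = e * thin i]%N].

Lemma wsum_thin_tail (R : realType) (E : set nat) (w h : nat -> R) N n :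
  (forall i, 0 <= w i) -> 0 <= h n -> E `<=` posnat ->
  (forall p, (0 < p)%N -> wsum w [set j | (p %| j)%N] n <= p%:R^-1 * h n) ->
  wsum w (mult (thin_part E [set i | (N < i)%N])) n <= thin_bound R N * h n.
Proof.
move=> w0 h0 E0 hp.
apply: (@le_trans _ _ (\sum_(i <- index_iota N n) wsum w [set j | (thin i.+1 %| j)%N] n)).
  apply: wsum_le_bigU => // j /andP[j0 jn] [_ [[|i] [e [Ni Ee ei ->]]] ej]; first by [].
  have tj : (thin i.+1 %| j)%N by apply: dvdn_trans ej; exact: dvdn_mull.
  exists i => //; rewrite mem_index_iota; apply/andP; split=> //.
  by have := ltn_thin i.+1; have := dvdn_leq j0 tj; lia.
apply: (@le_trans _ _ (\sum_(i <- index_iota N n) (thin i.+1)%:R^-1 * h n)).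
  by apply: ler_sum => i _; exact: hp.
by rewrite -mulr_suml ler_wpM2r// thin_sum_le.
Qed.

Lemma thin_dvd (E : set nat) N b : E `<=` posnat ->
  thin_part E [set i | (i <= N)%N] b -> (b %| (N.+1 * thin N)`!)%N.
Proof.
move=> E0 [i [e [/= iN /E0 e0 ei ->]]]; apply: dvdn_fact.
rewrite muln_gt0 thin_gt0 andbT; apply/andP; split=> //.
by apply: leq_mul; [lia|exact: thin_leq].
Qed.

Definition thin_multiples (E : set nat) : set nat := thin_part E setT.

Lemma thin_split (E : set nat) N b : thin_multiples E b ->
  thin_part E [set i | (i <= N)%N] b \/ thin_part E [set i | (N < i)%N] b.
Proof.
move=> [i [e [_ Ee ei bE]]].
by have [iN|Ni] := leqP i N; [left|right]; exists i, e.
Qed.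

Lemma thin_multiples_Besicovitch (R : realType) (E : set nat) : E `<=` posnat ->
  Besicovitch R (thin_multiples E).
Proof.
move=> E0; apply/BesicovitchE/density_approx => e e0.
pose N := Num.bound e^-1; pose q := (N.+1 * thin N)`!.
have q0 : (0 < q)%N by exact: fact_gt0.
have be : thin_bound R N <= e.
  have ei0 : 0 <= e^-1 by rewrite invr_ge0 ltW.
  rewrite -[leRHS]invrK lef_pV2 ?posrE ?invr_gt0 ?ltr0n ?muln_gt0 ?fact_gt0//.
  by rewrite (le_trans (ltW (archi_boundP ei0)))// ler_nat -/N; nia.
pose Y := thin_part E [set i | (i <= N)%N]; pose Z := thin_part E [set i | (N < i)%N].
exists (cnt R (mult Y) q / q%:R), q%:R => n.
have := @cnt_periodic R q (mult Y) n q0 (fun j _ => mult_periodic (fun b => @thin_dvd E N b E0) j).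
have lo : cnt R (mult Y) n <= cnt R (mult (thin_multiples E)) n.
  by apply: wsum_le => // j _; apply: multS => b [i [a [? ? ? ->]]]; exists i, a.
have hi : cnt R (mult (thin_multiples E)) n <= cnt R (mult Y) n + cnt R (mult Z) n.
  apply: wsum_leU => // j _ [b /(@thin_split _ N)[Yb|Zb] bj]; [left|right]; by exists b.
have hZ : cnt R (mult Z) n <= thin_bound R N * n%:R.
  apply: (@wsum_thin_tail R E _ (fun j => j%:R)) => // p p0.
  by rewrite mulrC; exact: cnt_dvd_le.
have : thin_bound R N * n%:R <= e * n%:R by rewrite ler_wpM2r.
rewrite !ler_norml => ? /andP[? ?]; apply/andP; split; lra.
Qed.

Lemma Behrend_dilators_thin (R : realType) (E : set nat) : E `<=` posnat ->
  Behrend_dilators R (thin_multiples E) `<=` mult (thin_multiples E).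
Proof.
move=> E0; apply: Behrend_dilators_sub (@sub_mult _) => c c0.
exists (c.+1 * thin c)`!, (thin_part E [set i | (c < i)%N]), (thin_bound R c); split.
- exact: fact_gt0.
- by move=> b /(@thin_split _ c)[/(thin_dvd E0)|]; [left|right].
- rewrite /thin_bound mulrC ltr_pdivrMr ?ltr0n ?muln_gt0 ?fact_gt0// mul1r ltr_nat.
  by rewrite ltn_mul2r fact_gt0 ltnS leqnn.
- move=> n0; exists n0 => //.
  apply: (@wsum_thin_tail R E _ (lsum R setT)) => [i|||p p0].
  + by rewrite inv_nat_ge0.
  + by apply: wsum_ge0 => i; rewrite inv_nat_ge0.
  + exact: E0.
  + exact: dvd_lsum_le.
Qed.

Lemma coprime_dilators_thin (E : set nat) : E `<=` posnat ->
  E `<=` coprime_dilators (thin_multiples E).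
Proof.
move=> E0 e Ee; split; first exact: E0.
exists (thin @` [set i | (e <= i)%N]); split.
- by move=> _ [i _ <-]; exact: thin_gt0.
- apply: infinite_unbounded => n; exists (thin (n + e)); first by exists (n + e)%N => //=; lia.
  by have := ltn_thin (n + e); lia.
- move=> _ _ [i _ <-] [j _ <-] ij.
  case: (ltngtP i j) => h; first exact: coprime_thin.
    by rewrite coprime_sym; exact: coprime_thin.
  by case: ij; rewrite h.
- by move=> _ [_ [i /= ei <-] <-]; exists i, e.
Qed.

(** * Tautification and star of the three constructions *)

Lemma star_Besicovitch1 (R : realType) B : B `<=` posnat ->
  coprime_dilators B 1 -> Besicovitch R (star B).
Proof.
by move=> B0 D1; apply/(Besicovitch_star R B0)/Besicovitch1; right.
Qed.

Lemma tautification_sandwich (R : realType) B E : B `<=` posnat ->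
  B `<=` mult E -> Behrend_dilators R B `<=` mult E ->
  E `<=` mult (B `|` Behrend_dilators R B) ->
  Besicovitch R (tautification R B) <-> Besicovitch R E.
Proof.
move=> B0 BE CE EX; rewrite Besicovitch_tautification//.
by apply: Besicovitch_sandwich => // b [/BE|/CE].
Qed.

Lemma star_sandwich (R : realType) B E : B `<=` posnat ->
  B `<=` mult E -> coprime_dilators B `<=` mult E ->
  E `<=` mult (B `|` coprime_dilators B) ->
  Besicovitch R (star B) <-> Besicovitch R E.
Proof.
move=> B0 BE CE EX; rewrite Besicovitch_star//.
by apply: Besicovitch_sandwich => // b [/BE|/CE].
Qed.

Lemma blocks_tautification (R : realType) k (S : block_system R k) :
  ~ Besicovitch R (tautification R (blocks S)).
Proof.
rewrite (@tautification_sandwich R _ (blocks S)).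
- exact: blocks_not_Besicovitch.
- exact: blocks_gt0.
- exact: sub_mult.
- by apply: Behrend_dilators_blocks; exact: sub_mult.
- by move=> b Eb; apply: sub_mult; left.
Qed.

Lemma blocks_star (R : realType) k (S : block_system R k) :
  Besicovitch R (star (blocks S)) <-> k = true.
Proof.
case: k S => S; split=> //.
  move=> _; apply: star_Besicovitch1; first exact: blocks_gt0.
  apply: (@coprime_dilators1 R _ S (fun=> 0%N)) => i; rewrite expn1.
  exists i => //; split; last by right.
  by have := scale_gt0 S i; lia.
rewrite (@star_sandwich R _ (blocks S)).
- by move=> /blocks_not_Besicovitch.
- exact: blocks_gt0.
- exact: sub_mult.
- by apply: coprime_dilators_blocks; exact: sub_mult.
- by move=> b Eb; apply: sub_mult; left.
Qed.

Lemma far_multiples_tautification (R : realType) k (S : block_system R k) :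
  ~ Besicovitch R (tautification R (far_multiples S)).
Proof.
rewrite (@tautification_sandwich R _ (blocks S)).
- exact: blocks_not_Besicovitch.
- exact: far_multiples_gt0.
- exact: far_multiples_sub.
- by apply: Behrend_dilators_blocks; exact: far_multiples_sub.
- move=> e Ee; apply: sub_mult; right; split; first exact: (blocks_gt0 Ee).
  case: Ee => i _ Fe; exists [set m | (scale S i.+1 < m)%N]; split.
    by apply: Behrend_tail; exact: scale_gt0.
  by move=> b [m sm <-]; exists i => //; exists e, m.
Qed.

Lemma far_multiples_star (R : realType) k (S : block_system R k) :
  Besicovitch R (star (far_multiples S)) <-> k = true.
Proof.
case: k S => S; split=> //.
  move=> _; apply: star_Besicovitch1; first exact: far_multiples_gt0.
  (* One factor [T_i + 1] is the block element; the remaining power, with exponent [scale S i.+1],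
     exceeds that scale. *)
  apply: (@coprime_dilators1 R _ S (fun i => scale S i.+1)) => i.
  have s0 := scale_gt0 S i.
  exists i => //; exists (scale S i).+1, ((scale S i).+1 ^ scale S i.+1)%N; split.
  - by split; [lia|right].
  - by apply: ltn_expl; lia.
  - by rewrite expnS.
rewrite (@star_sandwich R _ (blocks S)).
- by move=> /blocks_not_Besicovitch.
- exact: far_multiples_gt0.
- exact: far_multiples_sub.
- by apply: coprime_dilators_blocks; exact: far_multiples_sub.
- move=> e Ee; apply: sub_mult; right; case: (Ee) => i _ Fe.
  apply: (@coprime_dilators_primes _ _ (scale S i.+1)); first exact: (blocks_gt0 Ee).
  by move=> p _ sp; exists i => //; exists e, p.
Qed.

Lemma thin_multiples_gt0 (E : set nat) : E `<=` posnat -> thin_multiples E `<=` posnat.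
Proof.
by move=> E0 _ [i [e [_ /E0 e0 _ ->]]]; rewrite /posnat /= muln_gt0 thin_gt0 andbT.
Qed.

Lemma thin_multiples_sub (E : set nat) : thin_multiples E `<=` mult E.
Proof. by move=> _ [i [e [_ Ee _ ->]]]; exists e => //; exact: dvdn_mulr. Qed.

Lemma thin_multiples_tautification (R : realType) (E : set nat) : E `<=` posnat ->
  Besicovitch R (tautification R (thin_multiples E)).
Proof.
move=> E0; apply/(@tautification_sandwich R _ (thin_multiples E)).
- exact: thin_multiples_gt0.
- exact: sub_mult.
- exact: Behrend_dilators_thin.
- by move=> b Eb; apply: sub_mult; left.
- exact: thin_multiples_Besicovitch.
Qed.

Lemma thin_multiples_star (R : realType) (S : block_system R false) :
  ~ Besicovitch R (star (thin_multiples (blocks S))).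
Proof.
have E0 := @blocks_gt0 _ _ S.
rewrite (@star_sandwich R _ (blocks S)).
- exact: blocks_not_Besicovitch.
- exact: thin_multiples_gt0.
- exact: thin_multiples_sub.
- by apply: coprime_dilators_blocks; exact: thin_multiples_sub.
- by move=> e Ee; apply: sub_mult; right; exact: coprime_dilators_thin.
Qed.

Theorem mainTheorem5 (R : realType) (i j k : bool)
    (hij : (i, j) <> (false, true)) :
  exists B : set nat,
    [/\ B `<=` posnat,
        Besicovitch R B <-> i = true,
        Besicovitch R (tautification R B) <-> j = true
      & Besicovitch R (star B) <-> k = true].
Proof.
(* The flag is [k] itself: the added [T_i + 1] decide the star of [blocks] and of [far_multiples].
   The cases [(i, j)] then come in the order (0,0), (1,0), (1,1). *)
have [S] := block_system_exists R k.
case: i j hij => -[] // _; last first.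
- exists (blocks S); split; last exact: blocks_star.
  + exact: blocks_gt0.
  + by split=> // /blocks_not_Besicovitch.
  + by split=> // /blocks_tautification.
- exists (far_multiples S); split; last exact: far_multiples_star.
  + exact: far_multiples_gt0.
  + by split=> // _; exact: far_multiples_Besicovitch.
  + by split=> // /far_multiples_tautification.
case: k S => S.
  exists [set 1%N]; split; first by move=> _ ->.
  + by split=> // _; exact: Besicovitch1.
  + by split=> // _; apply/Besicovitch_tautification; [move=> _ ->|apply: Besicovitch1; left].
  + by split=> // _; apply/Besicovitch_star; [move=> _ ->|apply: Besicovitch1; left].
have E0 := @blocks_gt0 _ _ S.
exists (thin_multiples (blocks S)); split.
- exact: thin_multiples_gt0.
- by split=> // _; exact: thin_multiples_Besicovitch.
- by split=> // _; exact: thin_multiples_tautification.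
- by split=> // /thin_multiples_star.
Qed.
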